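(* Let $f=h+\overline{g}$ be a harmonic mapping in $\mathbb{D}$ and $F=H+\overline{G}\in\mathcal{B}_{H}$. If $h'+\overline{g'}\preceq H'+\overline{G'}$, then $\|P_f\|\leq\|P_F\|$. In this case, $f$ is uniformly locally univalent in $\mathbb{D}$.
   Context: $\mathbb{D}=\{z\in\mathbb{C}:|z|<1\}$. A harmonic mapping in $\mathbb{D}$ is written $f=h+\overline{g}$ with $h,g$ analytic in $\mathbb{D}$, $g(0)=0$; it is sense-preserving if $|h'|^2-|g'|^2>0$ in $\mathbb{D}$. The pre-Schwarzian derivative and norm are $$P_f=\frac{h''\overline{h'}-g''\overline{g'}}{|h'|^2-|g'|^2},\qquad \|P_f\|=\sup_{z\in\mathbb{D}}(1-|z|^2)|P_f(z)|.$$ $\mathcal{H}$ is the set of sense-preserving harmonic mappings $F=H+\overline G$ in $\mathbb{D}$ with $H(0)=H'(0)-1=G(0)=0$, and $\mathcal{B}_H=\{F\in\mathcal{H}:\|P_F\|<\infty\}$. For analytic functions $u,v,U,V$ in $\mathbb{D}$, $u+\overline{v}\preceq U+\overline{V}$ means that there exists an analytic function $\phi:\mathbb{D}\to\mathbb{D}$ (not necessarily fixing $0$) such that $u=U\circ\phi$ and $v=V\circ\phi$. Hyperbolic distance $d_h(z,a)=2\tanh^{-1}\left|\frac{z-a}{1-\overline{a}z}\right|$; $D_h(a,\rho)=\{z\in\mathbb{D}:d_h(z,a)<\rho\}$. A sense-preserving harmonic mapping $f$ is uniformly locally univalent (ULU) in $\mathbb{D}$ if $\inf_{z\in\mathbb{D}}\sup_{\rho_z>0}\{\rho_z:f\text{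 is univalent in }D_h(z,\rho_z)\}>0$. *)

(* Defs.v *)
From Stdlib Require Import Reals.
From Coquelicot Require Export Coquelicot.
Open Scope R_scope.

Definition disk (z : C) : Prop := Cmod z < 1.

Definition analytic_at (f : C -> C) (z : C) : Prop :=
  exists (a : nat -> C) (r : R), 0 < r /\
    forall w : C, Cmod (w - z)%C < r ->
      is_pseries (K := C_AbsRing) (V := C_NormedModule) a (w - z)%C (f w).

(* Functions on the disk are total functions on C whose values off the open
   disk are irrelevant; in particular derivatives at points of the disk do
   not depend on them. *)
Definition analytic_in_disk (f : C -> C) : Prop :=
  forall z : C, disk z -> analytic_at f z.

(* The decomposition f = h + conj g with g(0) = 0 is unique on the disk, so
   notions attached to f are stated in terms of h and g. *)
Definition harmonic_mapping (f h g : C -> C) : Prop :=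
  analytic_in_disk h /\ analytic_in_disk g /\ g 0%C = 0%C /\
  forall z : C, disk z -> f z = (h z + Cconj (g z))%C.

Definition jacobian (h g : C -> C) (z : C) : R :=
  Cmod (C_derive h z) ^ 2 - Cmod (C_derive g z) ^ 2.

Definition sense_preserving (h g : C -> C) : Prop :=
  forall z : C, disk z -> 0 < jacobian h g z.

Definition pre_schwarzian (h g : C -> C) (z : C) : C :=
  ((C_derive (C_derive h) z * Cconj (C_derive h z)
    - C_derive (C_derive g) z * Cconj (C_derive g z))
   / RtoC (jacobian h g z))%C.

Definition pre_schwarzian_norm (h g : C -> C) : Rbar :=
  Lub_Rbar (fun x : R => exists z : C, disk z /\
    x = (1 - Cmod z ^ 2) * Cmod (pre_schwarzian h g z)).

Definition class_H (F H G : C -> C) : Prop :=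
  harmonic_mapping F H G /\ sense_preserving H G /\
  H 0%C = 0%C /\ C_derive H 0%C = 1%C.

Definition class_BH (F H G : C -> C) : Prop :=
  class_H F H G /\ Rbar_lt (pre_schwarzian_norm H G) p_infty.

(* u + conj v is subordinate to U + conj V; phi need not fix 0. *)
Definition harmonic_subordinate (u v U V : C -> C) : Prop :=
  exists phi : C -> C,
    analytic_in_disk phi /\ (forall z : C, disk z -> disk (phi z)) /\
    (forall z : C, disk z -> u z = U (phi z)) /\
    (forall z : C, disk z -> v z = V (phi z)).

Definition artanh (x : R) : R := ln ((1 + x) / (1 - x)) / 2.

Definition hyp_dist (z a : C) : R :=
  2 * artanh (Cmod ((z - a) / (1 - Cconj a * z))%C).

Definition hyp_disk (a : C) (rho : R) (z : C) : Prop :=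
  disk z /\ hyp_dist z a < rho.

Definition univalent_on (f : C -> C) (D : C -> Prop) : Prop :=
  forall z w : C, D z -> D w -> f z = f w -> z = w.

(* The supremum is p_infty when f is univalent in the whole disk. *)
Definition univalence_radius (f : C -> C) (z : C) : Rbar :=
  Lub_Rbar (fun rho : R => 0 < rho /\ univalent_on f (hyp_disk z rho)).

Definition uniformly_locally_univalent (f h g : C -> C) : Prop :=
  harmonic_mapping f h g /\ sense_preserving h g /\
  Rbar_lt 0 (Rbar_glb (fun r : Rbar =>
    exists z : C, disk z /\ r = univalence_radius f z)).

(* Main.v *)
Require Import Defs.
From Stdlib Require Import Reals Lra Psatz.
From Coquelicot Require Import Coquelicot.

(** Write [phi] for the self-map of the disk with [h' = H' o phi] and
    [g' = G' o phi]. The Jacobian of [f] is that of [F] composed with [phi], and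
    the chain rule gives [P_f = (P_F o phi) * phi']. The Schwarz-Pick inequality
    [(1 - |z|^2) |phi' z| <= 1 - |phi z|^2] then yields [||P_f|| <= ||P_F||]
    ([pre_schwarzian_norm_subordinate]).

    It remains to see that a sense-preserving [f = h + conj g] with
    [||P_f|| <= M] is uniformly locally univalent. If [f z = f w], the increments
    of [h] and [g] between [w] and [z] have the same modulus, so that
    [h + e g] takes the same value at [z] and [w] for some [e] with [|e| = 1]
    ([univalent_of_shears]); it is enough to bound from below the size of the
    disks on which all these analytic functions [k = h + e g] are injective.
    Their second derivative splits into a part controlled by [P_f] and the
    Wronskian of [h'] and [g'], which the Schwarz-Pick inequality for the
    dilatation [g' / h'] controls; together
    [(1 - |z|^2) |k'' z| <= (M + 1) |k' z|] ([shear_derivative_bound]). Hence [k'] is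
    almost constant on the ball of radius [c (1 - |a|)] about [a], with [c]
    depending only on [M], and by the Noshiro-Warschawski argument [k] is
    injective there ([univalent_of_derivative_ratio]). This ball contains a
    hyperbolic disk of radius independent of [a] ([hyp_disk_in_ball]).

    Analyticity enters through two facts. A function with local power series
    has a derivative of the same kind ([analytic_at_derive]). And a self-map
    [Phi] of the disk with continuous derivative satisfies [|Phi' 0| <= 1]
    ([schwarz_derivative]), from which Schwarz-Pick follows by composing with
    automorphisms of the disk: the integral [I r] of
    [Re (exp (- i t) * Phi (r exp (i t)))] over a full turn satisfies
    [r * I' r = I r] by the Cauchy-Riemann equations, so [I r / r] is constant, and
    comparing its limit at [0] with the bound [2 * PI / r] gives
    [Re (Phi' 0) <= 1]. *)

(** * Complex continuity and differentiability *)

Definition ccont (f : C -> C) (z : C) : Prop :=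
  forall eps : R, 0 < eps -> exists d : R, 0 < d /\
    forall w : C, Cmod (w - z) < d -> Cmod (f w - f z) < eps.

(** Caratheodory's form of the complex derivative: the difference quotient
    extends continuously to [z] by the value [l]. With it, the product, chain
    and quotient rules are algebraic identities between the functions [q]
    together with the continuity rules. *)
Definition cderiv (f : C -> C) (z l : C) : Prop :=
  exists q : C -> C, ccont q z /\ q z = l /\
    forall w : C, (f w - f z = q w * (w - z))%C.

Lemma Cmod_sub_comm (z w : C) : Cmod (z - w) = Cmod (w - z).
Proof. rewrite <- Cmod_opp. f_equal. ring. Qed.

Lemma Cmod_sub_self (z : C) : Cmod (z - z) = 0.
Proof. rewrite <- Cmod_0. f_equal. ring. Qed.

Lemma Cmod_le_sub (z w : C) : Cmod w <= Cmod z + Cmod (w - z).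
Proof.
  replace w with (z + (w - z))%C at 1 by ring. apply Cmod_triangle.
Qed.

Lemma ccont_const (c z : C) : ccont (fun _ => c) z.
Proof.
  intros eps He. exists 1. split; [lra|]. intros w _. now rewrite Cmod_sub_self.
Qed.

Lemma ccont_id (z : C) : ccont (fun w => w) z.
Proof. intros eps He. now exists eps. Qed.

Lemma ccont_plus (f g : C -> C) (z : C) :
  ccont f z -> ccont g z -> ccont (fun w => f w + g w)%C z.
Proof.
  intros Hf Hg eps He.
  destruct (Hf (eps / 2)) as [d1 [Hd1 H1]]; [lra|].
  destruct (Hg (eps / 2)) as [d2 [Hd2 H2]]; [lra|].
  exists (Rmin d1 d2). split; [now apply Rmin_pos|]. intros w Hw.
  assert (A1 := H1 w (Rlt_le_trans _ _ _ Hw (Rmin_l _ _))).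
  assert (A2 := H2 w (Rlt_le_trans _ _ _ Hw (Rmin_r _ _))).
  replace (f w + g w - (f z + g z))%C with ((f w - f z) + (g w - g z))%C by ring.
  eapply Rle_lt_trans; [apply Cmod_triangle|]. lra.
Qed.

Lemma ccont_mult (f g : C -> C) (z : C) :
  ccont f z -> ccont g z -> ccont (fun w => f w * g w)%C z.
Proof.
  intros Hf Hg eps He.
  set (A := Cmod (f z)). set (B := Cmod (g z)).
  assert (HA : 0 <= A) by apply Cmod_ge_0.
  assert (HB : 0 <= B) by apply Cmod_ge_0.
  destruct (Hf (Rmin 1 (eps / (2 * (B + 1))))) as [d1 [Hd1 H1]].
  { apply Rmin_pos; [lra|]. apply Rdiv_lt_0_compat; lra. }
  destruct (Hg (eps / (2 * (A + 1)))) as [d2 [Hd2 H2]].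
  { apply Rdiv_lt_0_compat; lra. }
  exists (Rmin d1 d2). split; [now apply Rmin_pos|]. intros w Hw.
  assert (A1 := H1 w (Rlt_le_trans _ _ _ Hw (Rmin_l _ _))).
  assert (A2 := H2 w (Rlt_le_trans _ _ _ Hw (Rmin_r _ _))).
  assert (A3 := Rlt_le_trans _ _ _ A1 (Rmin_l _ _)).
  assert (A4 := Rlt_le_trans _ _ _ A1 (Rmin_r _ _)).
  replace (f w * g w - f z * g z)%C
    with (f w * (g w - g z) + (f w - f z) * g z)%C by ring.
  eapply Rle_lt_trans; [apply Cmod_triangle|]. rewrite 2!Cmod_mult. fold B.
  assert (A5 : Cmod (f w) <= A + 1).
  { pose proof (Cmod_le_sub (f z) (f w)). fold A in H. lra. }
  assert (E1 : Cmod (f w) * Cmod (g w - g z) <= eps / 2).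
  { apply Rle_trans with ((A + 1) * (eps / (2 * (A + 1)))).
    - apply Rmult_le_compat; try apply Cmod_ge_0; lra.
    - right. field. lra. }
  assert (E2 : Cmod (f w - f z) * B < eps / 2).
  { apply Rle_lt_trans with (eps / (2 * (B + 1)) * B).
    - apply Rmult_le_compat_r; lra.
    - apply Rlt_le_trans with (eps / (2 * (B + 1)) * (B + 1)).
      + apply Rmult_lt_compat_l; [|lra]. apply Rdiv_lt_0_compat; lra.
      + right. field. lra. }
  lra.
Qed.

Lemma ccont_comp (f g : C -> C) (z : C) :
  ccont g z -> ccont f (g z) -> ccont (fun w => f (g w)) z.
Proof.
  intros Hg Hf eps He. destruct (Hf eps He) as [d [Hd H]].
  destruct (Hg d Hd) as [d' [Hd' H']]. exists d'. split; auto.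
Qed.

Lemma ccont_Cinv (z : C) : z <> 0%C -> ccont Cinv z.
Proof.
  intros Hz eps He. assert (Hm := proj1 (Cmod_gt_0 z) Hz).
  exists (Rmin (Cmod z / 2) (eps * (Cmod z * Cmod z) / 2)).
  assert (0 < Cmod z * Cmod z) by now apply Rmult_lt_0_compat.
  split.
  { apply Rmin_pos; [lra|]. apply Rdiv_lt_0_compat; [|lra].
    now apply Rmult_lt_0_compat. }
  intros w Hw.
  assert (H1 := Rlt_le_trans _ _ _ Hw (Rmin_l _ _)).
  assert (H2 := Rlt_le_trans _ _ _ Hw (Rmin_r _ _)).
  assert (Hwm : Cmod z / 2 < Cmod w).
  { pose proof (Cmod_le_sub w z). rewrite Cmod_sub_comm in H0. lra. }
  assert (Hw0 : w <> 0%C). { apply Cmod_gt_0. lra. }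
  replace (/ w - / z)%C with (- (w - z) / (w * z))%C by (field; auto).
  rewrite Cmod_div by now apply Cmult_neq_0.
  rewrite Cmod_opp, Cmod_mult. apply Rlt_div_l.
  - apply Rmult_lt_0_compat; lra.
  - eapply Rlt_le_trans; [exact H2|].
    replace (eps * (Cmod z * Cmod z) / 2) with (eps * (Cmod z / 2 * Cmod z))
      by field.
    apply Rmult_le_compat_l; [lra|]. apply Rmult_le_compat_r; lra.
Qed.

Lemma ccont_inv (f : C -> C) (z : C) :
  ccont f z -> f z <> 0%C -> ccont (fun w => / f w)%C z.
Proof. intros Hf Hz. apply (ccont_comp Cinv f); auto. now apply ccont_Cinv. Qed.

Lemma ccont_ext_loc (f g : C -> C) (z : C) (r : R) :
  0 < r -> (forall w, Cmod (w - z) < r -> f w = g w) -> ccont f z -> ccont g z.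
Proof.
  intros Hr E Hf eps He. destruct (Hf eps He) as [d [Hd H]].
  exists (Rmin d r). split; [now apply Rmin_pos|]. intros w Hw.
  rewrite <- !E; [apply H| |].
  - eapply Rlt_le_trans; [exact Hw|apply Rmin_l].
  - now rewrite Cmod_sub_self.
  - eapply Rlt_le_trans; [exact Hw|apply Rmin_r].
Qed.

Lemma cderiv_ccont (f : C -> C) (z l : C) : cderiv f z l -> ccont f z.
Proof.
  intros [q [Hq [_ E]]].
  apply (ccont_ext_loc (fun w => f z + q w * (w + - z))%C _ _ 1); [lra| |].
  - intros w _. pose proof (E w). replace (w + - z)%C with (w - z)%C by ring.
    rewrite <- H. ring.
  - apply ccont_plus; [apply ccont_const|]. apply ccont_mult; [exact Hq|].
    apply ccont_plus; [apply ccont_id|apply ccont_const].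
Qed.

Lemma cderiv_const (c z : C) : cderiv (fun _ => c) z 0%C.
Proof.
  exists (fun _ => 0%C). split; [apply ccont_const|]. split; [easy|]. intros w. ring.
Qed.

Lemma cderiv_id (z : C) : cderiv (fun w => w) z 1%C.
Proof.
  exists (fun _ => 1%C). split; [apply ccont_const|]. split; [easy|]. intros w. ring.
Qed.

Lemma cderiv_plus (f g : C -> C) (z l m : C) :
  cderiv f z l -> cderiv g z m -> cderiv (fun w => f w + g w)%C z (l + m)%C.
Proof.
  intros [p [Hp [<- Ep]]] [q [Hq [<- Eq]]].
  exists (fun w => p w + q w)%C. split; [now apply ccont_plus|]. split; [easy|].
  intros w.
  replace (f w + g w - (f z + g z))%C with ((f w - f z) + (g w - g z))%C by ring.
  rewrite Ep, Eq. ring.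
Qed.

Lemma cderiv_mult (f g : C -> C) (z l m : C) :
  cderiv f z l -> cderiv g z m ->
  cderiv (fun w => f w * g w)%C z (l * g z + f z * m)%C.
Proof.
  intros Hf [q [Hq [<- Eq]]]. pose proof (cderiv_ccont _ _ _ Hf) as Cf.
  destruct Hf as [p [Hp [<- Ep]]].
  exists (fun w => p w * g z + f w * q w)%C. split.
  - apply ccont_plus; apply ccont_mult; auto using ccont_const.
  - split; [easy|]. intros w.
    replace (f w * g w - f z * g z)%C
      with ((f w - f z) * g z + f w * (g w - g z))%C by ring.
    rewrite Ep, Eq. ring.
Qed.

Lemma cderiv_scal (c : C) (f : C -> C) (z l : C) :
  cderiv f z l -> cderiv (fun w => c * f w)%C z (c * l)%C.
Proof.
  intros Hf. replace (c * l)%C with (0 * f z + c * l)%C by ring.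
  apply (cderiv_mult (fun _ => c)); [apply cderiv_const|exact Hf].
Qed.

Lemma cderiv_comp (f g : C -> C) (z l m : C) :
  cderiv f (g z) l -> cderiv g z m -> cderiv (fun w => f (g w)) z (l * m)%C.
Proof.
  intros [p [Hp [<- Ep]]] Hg. pose proof (cderiv_ccont _ _ _ Hg) as Cg.
  destruct Hg as [q [Hq [<- Eq]]].
  exists (fun w => p (g w) * q w)%C. split.
  - apply ccont_mult; [|exact Hq]. now apply (ccont_comp p g).
  - split; [easy|]. intros w. rewrite Ep, Eq. ring.
Qed.

(** The factorisation is only needed near [z]: away from [z] the quotient
    itself serves as [q]. *)
Lemma cderiv_intro (f q : C -> C) (z : C) (r : R) :
  0 < r -> ccont q z ->
  (forall w, Cmod (w - z) < r -> (f w - f z = q w * (w - z))%C) ->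
  cderiv f z (q z).
Proof.
  intros Hr Hq E.
  exists (fun w => if Ceq_dec w z then q z else ((f w - f z) / (w - z))%C).
  split; [|split].
  - apply (ccont_ext_loc q _ _ r Hr); [|exact Hq]. intros w Hw.
    destruct (Ceq_dec w z) as [->|N]; [easy|]. rewrite E by easy.
    field. intros H. apply N. replace w with ((w - z) + z)%C by ring.
    rewrite H. ring.
  - now destruct (Ceq_dec z z).
  - intros w. destruct (Ceq_dec w z) as [->|N]; [ring|].
    field. intros H. apply N. replace w with ((w - z) + z)%C by ring.
    rewrite H. ring.
Qed.

Lemma cderiv_ext_loc (f g : C -> C) (z l : C) (r : R) :
  0 < r -> (forall w, Cmod (w - z) < r -> f w = g w) -> cderiv f z l ->
  cderiv g z l.
Proof.
  intros Hr E [q [Hq [<- Eq]]]. apply (cderiv_intro g q z r Hr Hq).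
  intros w Hw. rewrite <- !E; auto. now rewrite Cmod_sub_self.
Qed.

Lemma cderiv_Cinv (z : C) : z <> 0%C -> cderiv Cinv z (- / (z * z))%C.
Proof.
  intros Hz.
  replace (- / (z * z))%C with ((- (1)) * / (z * z))%C by (field; auto).
  apply (cderiv_intro Cinv (fun w => (- (1)) * / (w * z))%C z (Cmod z)).
  - now apply Cmod_gt_0.
  - apply ccont_mult; [apply ccont_const|].
    apply ccont_inv; [|now apply Cmult_neq_0].
    apply ccont_mult; [apply ccont_id|apply ccont_const].
  - intros w Hw. assert (w <> 0%C).
    { apply Cmod_gt_0. pose proof (Cmod_le_sub w z).
      rewrite Cmod_sub_comm in H. lra. }
    field. auto.
Qed.

Lemma cderiv_div (f g : C -> C) (z l m : C) :
  g z <> 0%C -> cderiv f z l -> cderiv g z m ->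
  cderiv (fun w => f w / g w)%C z ((l * g z - f z * m) / (g z * g z))%C.
Proof.
  intros G0 Hf Hg.
  replace ((l * g z - f z * m) / (g z * g z))%C
    with (l * / g z + f z * (- / (g z * g z) * m))%C by (field; auto).
  apply (cderiv_mult f (fun w => / g w)%C); [exact Hf|].
  apply (cderiv_comp Cinv g); [now apply cderiv_Cinv|exact Hg].
Qed.

(** The form in which a power series delivers its derivative: a second order
    Taylor remainder. *)
Lemma cderiv_of_quadratic (f : C -> C) (z l : C) (r K : R) :
  0 < r ->
  (forall w, Cmod (w - z) < r ->
     Cmod (f w - f z - l * (w - z)) <= K * Cmod (w - z) ^ 2) ->
  cderiv f z l.
Proof.
  intros Hr H.
  set (q := fun w => if Ceq_dec w z then l else ((f w - f z) / (w - z))%C).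
  assert (Hqz : q z = l) by (unfold q; now destruct (Ceq_dec z z)).
  assert (Hq : forall w, (f w - f z = q w * (w - z))%C).
  { intros w. unfold q. destruct (Ceq_dec w z) as [->|N]; [ring|].
    field. intros A. apply N. replace w with ((w - z) + z)%C by ring.
    rewrite A. ring. }
  exists q. split; [|now split].
  intros eps He. exists (Rmin r (eps / (Rabs K + 1))).
  assert (HK := Rabs_pos K).
  split. { apply Rmin_pos; [lra|]. apply Rdiv_lt_0_compat; lra. }
  intros w Hw. assert (H1 := Rlt_le_trans _ _ _ Hw (Rmin_l _ _)).
  assert (H2 := Rlt_le_trans _ _ _ Hw (Rmin_r _ _)).
  apply Rlt_div_r in H2; [|lra].
  destruct (Ceq_dec w z) as [->|N]; [now rewrite Cmod_sub_self|].
  assert (W : 0 < Cmod (w - z)).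
  { apply Cmod_gt_0. intros A. apply N. replace w with ((w - z) + z)%C by ring.
    rewrite A. ring. }
  specialize (H w H1). rewrite Hq in H. rewrite Hqz.
  replace (q w * (w - z) - l * (w - z))%C with ((q w - l) * (w - z))%C in H by ring.
  rewrite Cmod_mult in H. pose proof (Rle_abs K).
  assert (Cmod (q w - l) <= K * Cmod (w - z)) by nra. nra.
Qed.

Lemma cderiv_C_derive (f : C -> C) (z l : C) : cderiv f z l -> C_derive f z = l.
Proof.
  intros [q [Hq [<- E]]]. apply is_C_derive_unique. split.
  - apply (is_linear_scal_l (K := C_AbsRing) (V := C_NormedModule)).
  - intros x Hx eps.
    apply (is_filter_lim_locally_unique (V := AbsRing_NormedModule C_AbsRing)) in Hx.
    subst x.
    destruct (Hq eps (cond_pos eps)) as [d [Hd H]].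
    exists (mkposreal d Hd). intros w Hw.
    change (Cmod (f w - f z - (w - z) * q z) <= eps * Cmod (w - z)).
    rewrite E. replace (q w * (w - z) - (w - z) * q z)%C
      with ((q w - q z) * (w - z))%C by ring.
    rewrite Cmod_mult. apply Rmult_le_compat_r; [apply Cmod_ge_0|].
    apply Rlt_le, H. exact Hw.
Qed.

(** * Differentiation of power series *)

Notation is_Cseries := (is_series (K := C_AbsRing) (V := C_NormedModule)).

Lemma is_pseries_Cpow (a : nat -> C) (x l : C) :
  is_pseries (K := C_AbsRing) (V := C_NormedModule) a x l <->
  is_Cseries (fun n => (x ^ n * a n)%C) l.
Proof.
  assert (E : forall n, pow_n (K := C_AbsRing) x n = (x ^ n)%C).
  { induction n as [|n IH]; [easy|]. simpl. now rewrite IH. }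
  unfold is_pseries. split; apply is_series_ext; intros n.
  - exact (f_equal (fun p => (p * a n)%C) (E n)).
  - exact (f_equal (fun p => (p * a n)%C) (eq_sym (E n))).
Qed.

(** Comparison with a real series, keeping the bound on the sum: this is what
    turns termwise estimates into an estimate of a Taylor remainder. *)
Lemma is_Cseries_dominated (u : nat -> C) (v : nat -> R) :
  (forall n, Cmod (u n) <= v n) -> ex_series v ->
  exists l : C, is_Cseries u l /\ Cmod l <= Series v.
Proof.
  intros H Hv.
  destruct (ex_series_le (K := C_AbsRing) (V := C_CompleteNormedModule) u v H Hv)
    as [l Hl].
  exists l. split; [exact Hl|].
  apply (filterlim_le (F := eventually)
           (fun n => Cmod (sum_n (G := C_AbelianMonoid) u n)) (sum_n v)
           (Cmod l) (Series v)).
  - exists 0%nat. intros n _. induction n as [|n IH].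
    + rewrite !sum_O. apply H.
    + rewrite !sum_Sn. eapply Rle_trans; [apply Cmod_triangle|].
      apply Rplus_le_compat; [exact IH|apply H].
  - eapply filterlim_comp; [exact Hl|].
    apply (filterlim_norm (K := C_AbsRing) (V := C_NormedModule)).
  - apply Series_correct, Hv.
Qed.

Definition pow_remainder (x y : C) (n : nat) : C :=
  (y ^ n - x ^ n - RtoC (INR n) * x ^ pred n * (y - x))%C.

(** Induction on [n] from
    [E_(n+1) = y * E_n + n * x^(n-1) * (y - x)^2]. The factor [s ^ 2] on the left
    avoids the exponent [n - 2] on the right. *)
Lemma pow_remainder_bound (x y : C) (s : R) (n : nat) :
  Cmod x <= s -> Cmod y <= s ->
  s ^ 2 * Cmod (pow_remainder x y n) <= INR n ^ 2 * s ^ n * Cmod (y - x) ^ 2.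
Proof.
  intros Hx Hy. assert (Hs : 0 <= s) by (pose proof (Cmod_ge_0 x); lra).
  assert (Hd : 0 <= Cmod (y - x) ^ 2) by (apply pow_le, Cmod_ge_0).
  assert (D : forall m, s * (INR m * Cmod (x ^ pred m)) <= INR m * s ^ m).
  { intros [|m]; [simpl; lra|]. simpl pred. rewrite Cmod_pow.
    assert (Cmod x ^ m <= s ^ m) by (apply pow_incr; split; [apply Cmod_ge_0|easy]).
    pose proof (pos_INR (S m)). rewrite <- tech_pow_Rmult.
    apply Rle_trans with (INR (S m) * s * s ^ m); [|right; ring].
    replace (s * (INR (S m) * Cmod x ^ m)) with (INR (S m) * s * Cmod x ^ m) by ring.
    apply Rmult_le_compat_l; [now apply Rmult_le_pos|easy]. }
  induction n as [|n IH].
  - replace (pow_remainder x y 0) with (RtoC 0)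
      by (unfold pow_remainder; simpl; ring).
    rewrite Cmod_0. simpl. lra.
  - assert (E : pow_remainder x y (S n) =
      (y * pow_remainder x y n
       + (RtoC (INR n) * x ^ pred n) * ((y - x) * (y - x)))%C).
    { unfold pow_remainder. rewrite S_INR, RtoC_plus. simpl pred.
      destruct n as [|n]; [simpl; ring|]. simpl pred. rewrite !Cpow_S. ring. }
    rewrite E.
    apply Rle_trans with (s ^ 2 * (Cmod y * Cmod (pow_remainder x y n)
      + INR n * Cmod (x ^ pred n) * Cmod (y - x) ^ 2)).
    { apply Rmult_le_compat_l; [now apply pow_le|].
      eapply Rle_trans; [apply Cmod_triangle|]. rewrite !Cmod_mult, Cmod_R.
      rewrite (Rabs_pos_eq (INR n)) by apply pos_INR. right. ring. }
    set (P := Cmod (pow_remainder x y n)) in *.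
    set (Q := Cmod (x ^ pred n)) in *. set (k := Cmod (y - x) ^ 2) in *.
    assert (A1 : Cmod y * (s ^ 2 * P) <= s * (INR n ^ 2 * s ^ n * k)).
    { apply Rmult_le_compat; auto using Cmod_ge_0.
      apply Rmult_le_pos; [now apply pow_le|apply Cmod_ge_0]. }
    assert (A2 : s * k * (s * (INR n * Q)) <= s * k * (INR n * s ^ n)).
    { apply Rmult_le_compat_l; auto. now apply Rmult_le_pos. }
    rewrite S_INR. pose proof (pos_INR n).
    rewrite <- (tech_pow_Rmult s n).
    assert (0 <= s * s ^ n * k).
    { apply Rmult_le_pos; [|easy]. apply Rmult_le_pos; [easy|now apply pow_le]. }
    assert (0 <= (INR n + 1) * (s * s ^ n * k)) by (apply Rmult_le_pos; lra).
    clear - A1 A2 H1. set (W := s ^ n) in *. lra.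
Qed.

Lemma is_Cseries_bounded (u : nat -> C) (l : C) :
  is_Cseries u l -> exists M, forall n, Cmod (u n) <= M.
Proof.
  intros H.
  destruct (filterlim_bounded (K := C_AbsRing) (V := C_NormedModule)
              (sum_n u) (ex_intro _ l H)) as [M HM].
  assert (M0 : 0 <= M) by (eapply Rle_trans; [apply Cmod_ge_0|apply (HM 0%nat)]).
  exists (2 * M). intros [|n].
  - specialize (HM 0%nat). rewrite sum_O in HM.
    change (Cmod (u 0%nat) <= M) in HM. lra.
  - assert (H1 := HM n). assert (H2 := HM (S n)). rewrite sum_Sn in H2.
    set (S := sum_n u n) in *. change (Cmod S <= M) in H1.
    change (Cmod (S + u (Datatypes.S n))%C <= M) in H2.
    replace (u (Datatypes.S n)) with ((S + u (Datatypes.S n)) + - S)%C by ring.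
    eapply Rle_trans; [apply Cmod_triangle|]. rewrite Cmod_opp. lra.
Qed.

(** Cauchy's bound on the coefficients at radius [rho] leaves room for
    polynomial weights at any smaller radius: the weights come from formal
    differentiation, which does not change the radius of convergence. *)
Lemma ex_series_weighted (b : nat -> R) (rho s : R) (M : R) :
  (forall n, Rabs (b n * rho ^ n) <= M) -> 0 <= s < rho ->
  ex_series (fun n => Rabs (INR (S n) * b (S n) * s ^ n)) /\
  ex_series (fun n => Rabs (INR n ^ 2 * b n * s ^ n)).
Proof.
  intros HM Hs.
  assert (R0 : Rbar_lt (Rabs s) (CV_radius b)).
  { apply Rbar_lt_le_trans with (Finite rho).
    - rewrite Rabs_pos_eq; simpl; lra.
    - apply CV_radius_bounded. now exists M. }
  split.
  - apply (CV_disk_inside (PS_derive b)). now rewrite CV_radius_derive.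
  - pose (T := fun a => PS_incr_1 (PS_derive a)).
    apply (ex_series_ext (fun n => Rabs (T (T b) n * s ^ n))).
    (* T multiplies the n-th coefficient by n *)
    + intros [|n]; unfold T, PS_incr_1, PS_derive.
      * f_equal. change (0 * s ^ 0 = INR 0 ^ 2 * b 0%nat * s ^ 0). simpl. ring.
      * f_equal. ring.
    + apply CV_disk_inside. unfold T.
      now rewrite CV_radius_incr_1, CV_radius_derive, CV_radius_incr_1,
        CV_radius_derive.
Qed.

(** Termwise differentiation. Summing the remainders of the powers gives a
    quadratic error for the sum of the differentiated series, which is
    therefore the derivative at every point of a smaller disk; in particular
    the derivative is again given by a power series there. *)
Lemma analytic_at_derive (f : C -> C) (z0 : C) :
  analytic_at f z0 ->
  (exists r, 0 < r /\
     forall w, Cmod (w - z0) < r -> cderiv f w (C_derive f w)) /\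
  analytic_at (C_derive f) z0.
Proof.
  intros [a [r [Hr Ha]]].
  (* Convergence at distance rho bounds the coefficients; the estimates hold
     at the smaller distance s. *)
  set (rho := r / 2).
  assert (Hrho : 0 < rho) by (unfold rho; lra).
  assert (B : exists M, forall n, Rabs (Cmod (a n) * rho ^ n) <= M).
  { destruct (is_Cseries_bounded (fun n => (RtoC rho ^ n * a n)%C)
                (f (z0 + rho)%C)) as [M HM].
    - assert (A := Ha (z0 + rho)%C).
      replace (z0 + rho - z0)%C with (RtoC rho) in A by ring.
      apply (proj1 (is_pseries_Cpow _ _ _)), A.
      rewrite Cmod_R, Rabs_pos_eq; unfold rho; lra.
    - exists M. intros n. specialize (HM n).
      rewrite Cmod_mult, Cmod_pow, Cmod_R in HM.
      rewrite Rabs_mult, <- RPow_abs, Rabs_pos_eq by apply Cmod_ge_0. lra. }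
  destruct B as [M HM].
  set (s := rho / 2). assert (Hs : 0 < s < rho) by (unfold s; lra).
  destruct (ex_series_weighted (fun n => Cmod (a n)) rho s M HM) as [S1 S2]; [lra|].
  set (a1 := fun n => (RtoC (INR (S n)) * a (S n))%C).
  assert (Main : forall w, Cmod (w - z0) < s -> exists l : C,
    is_pseries (K := C_AbsRing) (V := C_NormedModule) a1 (w - z0)%C l /\
    cderiv f w l).
  { intros w Hw.
    assert (T1 : forall n, Cmod ((w - z0) ^ n * a1 n)
                   <= Rabs (INR (S n) * Cmod (a (S n)) * s ^ n)).
    { intros n. unfold a1. rewrite !Cmod_mult, Cmod_pow, Cmod_R, !Rabs_mult.
      rewrite (Rabs_pos_eq (INR (S n))) by apply pos_INR.
      rewrite (Rabs_pos_eq (Cmod _)) by apply Cmod_ge_0.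
      rewrite (Rabs_pos_eq (s ^ n)) by (apply pow_le; lra).
      rewrite Rmult_comm. apply Rmult_le_compat_l.
      - apply Rmult_le_pos; [apply pos_INR|apply Cmod_ge_0].
      - apply pow_incr. split; [apply Cmod_ge_0|lra]. }
    destruct (is_Cseries_dominated _ _ T1 S1) as [l [Hl _]].
    exists l. split; [now apply (proj2 (is_pseries_Cpow _ _ _))|].
    apply (cderiv_of_quadratic f w l (s - Cmod (w - z0))
             (Series (fun n => Rabs (INR n ^ 2 * Cmod (a n) * s ^ n)) / s ^ 2));
      [lra|].
    intros y Hy.
    assert (Hyz : Cmod (y - z0) < s).
    { replace (y - z0)%C with ((y - w) + (w - z0))%C by ring.
      eapply Rle_lt_trans; [apply Cmod_triangle|]. lra. }
    assert (Fy := Ha y ltac:(unfold s, rho in *; lra)).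
    apply (proj1 (is_pseries_Cpow _ _ _)) in Fy.
    assert (Fw := Ha w ltac:(unfold s, rho in *; lra)).
    apply (proj1 (is_pseries_Cpow _ _ _)) in Fw.
    (* The differentiated series is padded with a zero term, to be indexed like
       the other two. *)
    assert (Fl : is_Cseries
      (fun n => (RtoC (INR n) * (w - z0) ^ pred n * a n * (y - w))%C)
      (l * (y - w))%C).
    { apply (is_series_ext (fun n => (y - w) *
         (RtoC (INR n) * (w - z0) ^ pred n * a n))%C).
      { intros n. match goal with |- ?x = ?y => change (@eq C x y) end. ring. }
      rewrite Cmult_comm.
      apply (is_series_scal (K := C_AbsRing) (V := C_NormedModule) (y - w)%C
        (fun n => (RtoC (INR n) * (w - z0) ^ pred n * a n)%C)).
      apply is_series_decr_1.
      replace (plus _ _) with l.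
      - revert Hl. apply is_series_ext. intros n.
        match goal with |- ?x = ?y => change (@eq C x y) end.
        unfold a1. simpl pred. ring.
      - change (@eq C l (l + - (0 * (w - z0) ^ 0 * a 0%nat))%C). ring. }
    pose proof (is_series_minus _ _ _ _ (is_series_minus _ _ _ _ Fy Fw) Fl) as FF.
    set (D := Cmod (y - w) ^ 2 / s ^ 2).
    assert (T2 : forall n, Cmod (a n * pow_remainder (w - z0) (y - z0) n)
                   <= Rabs (INR n ^ 2 * Cmod (a n) * s ^ n) * D).
    { intros n.
      pose proof (pow_remainder_bound (w - z0) (y - z0) s n (Rlt_le _ _ Hw)
                    (Rlt_le _ _ Hyz)) as P.
      replace (y - z0 - (w - z0))%C with (y - w)%C in P by ring.
      rewrite Cmod_mult, Rabs_pos_eq.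
      2:{ repeat apply Rmult_le_pos; try apply pos_INR; try apply Cmod_ge_0;
          try (apply pow_le; lra). simpl. pose proof (pos_INR n). nra. }
      apply Rmult_le_reg_l with (s ^ 2); [apply pow_lt; lra|].
      replace (s ^ 2 * (INR n ^ 2 * Cmod (a n) * s ^ n * D))
        with (Cmod (a n) * (INR n ^ 2 * s ^ n * Cmod (y - w) ^ 2))
        by (unfold D; field; lra).
      replace (s ^ 2 * (Cmod (a n) * Cmod (pow_remainder (w - z0) (y - z0) n)))
        with (Cmod (a n) * (s ^ 2 * Cmod (pow_remainder (w - z0) (y - z0) n)))
        by ring.
      apply Rmult_le_compat_l; [apply Cmod_ge_0|exact P]. }
    destruct (is_Cseries_dominated _ _ T2) as [m [Hm1 Hm2]].
    { now apply ex_series_scal_r. }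
    assert (E : (f y - f w - l * (y - w))%C = m).
    { assert (FF' : is_Cseries
        (fun n => (a n * pow_remainder (w - z0) (y - z0) n)%C)
        (f y - f w - l * (y - w))%C).
      { revert FF. apply is_series_ext. intros n. unfold pow_remainder.
        change (@eq C ((y - z0) ^ n * a n + - ((w - z0) ^ n * a n)
               + - (RtoC (INR n) * (w - z0) ^ pred n * a n * (y - w)))%C
          (a n * ((y - z0) ^ n - (w - z0) ^ n
             - RtoC (INR n) * (w - z0) ^ pred n * (y - z0 - (w - z0))))%C).
        ring. }
      exact (filterlim_locally_unique (F := eventually)
               (V := C_NormedModule) _ _ _ FF' Hm1). }
    rewrite E. eapply Rle_trans; [exact Hm2|].
    rewrite Series_scal_r. unfold D. right. field. lra. }
  split.
  - exists s. split; [easy|]. intros w Hw. destruct (Main w Hw) as [l [_ Hl]].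
    now rewrite (cderiv_C_derive _ _ _ Hl).
  - exists a1, s. split; [easy|]. intros w Hw. destruct (Main w Hw) as [l [Hl D]].
    now rewrite (cderiv_C_derive _ _ _ D).
Qed.

(** * Holomorphic functions along real curves *)

Lemma Cmod_le_coords (x y : R) : Cmod (x, y) <= Rabs x + Rabs y.
Proof.
  replace (x, y) with (RtoC x + RtoC y * Ci)%C
    by (unfold RtoC, Ci, Cmult, Cplus; simpl; f_equal; ring).
  eapply Rle_trans; [apply Cmod_triangle|].
  rewrite Cmod_mult, !Cmod_R, Cmod_Ci. lra.
Qed.

Lemma ccont_filterlim {T : Type} (F : (T -> Prop) -> Prop) {FF : Filter F}
  (f : C -> C) (X Y : T -> R) (a b : R) :
  ccont f (a, b) -> filterlim X F (locally a) -> filterlim Y F (locally b) ->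
  filterlim (fun s => Re (f (X s, Y s))) F (locally (Re (f (a, b)))).
Proof.
  intros Hf HX HY. apply filterlim_locally. intros eps.
  destruct (Hf eps (cond_pos eps)) as [d [Hd H]].
  assert (Hd2 : 0 < d / 2) by lra.
  assert (AX := proj1 (filterlim_locally X a) HX (mkposreal _ Hd2)).
  assert (AY := proj1 (filterlim_locally Y b) HY (mkposreal _ Hd2)).
  generalize (filter_and _ _ AX AY). apply filter_imp. intros s [H1 H2].
  change (Rabs (X s - a) < d / 2) in H1. change (Rabs (Y s - b) < d / 2) in H2.
  change (Rabs (Re (f (X s, Y s)) - Re (f (a, b))) < eps).
  replace (Re (f (X s, Y s)) - Re (f (a, b)))
    with (Re (f (X s, Y s) - f (a, b))%C) by (unfold Re; simpl; ring).
  eapply Rle_lt_trans; [apply re_le_Cmod|]. apply H.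
  replace ((X s, Y s) - (a, b))%C with (X s - a, Y s - b) by reflexivity.
  eapply Rle_lt_trans; [apply Cmod_le_coords|]. lra.
Qed.

Lemma ccont_continuous_curve (f : C -> C) (x y : R -> R) (t : R) :
  ccont f (x t, y t) -> continuous x t -> continuous y t ->
  continuous (fun s => Re (f (x s, y s))) t.
Proof. intros Hf Hx Hy. now apply (ccont_filterlim (locally t) f x y). Qed.

Lemma ccont_continuity_2d (f : C -> C) (X Y : R -> R -> R) (u v : R) :
  ccont f (X u v, Y u v) -> continuity_2d_pt X u v -> continuity_2d_pt Y u v ->
  continuity_2d_pt (fun u v => Re (f (X u v, Y u v))) u v.
Proof.
  intros Hf HX HY. apply continuity_2d_pt_filterlim.
  apply continuity_2d_pt_filterlim in HX, HY.
  now apply (ccont_filterlim (locally (u, v)) f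
    (fun p => X (fst p) (snd p)) (fun p => Y (fst p) (snd p))).
Qed.

(** The product rule at a zero of one factor: the other factor is only
    required to be continuous, like the quotient [q] in [cderiv]. *)
Lemma is_derive_continuous_mult_increment (u x : R -> R) (t a : R) :
  continuous u t -> is_derive x t a ->
  is_derive (fun s => u s * (x s - x t)) t (u t * a).
Proof.
  intros Hu Hx. apply is_derive_Reals. apply is_derive_Reals in Hx.
  intros eps He.
  assert (Pu := Rabs_pos (u t)). assert (Pa := Rabs_pos a).
  assert (E1 : 0 < eps / (2 * (Rabs (u t) + 1))) by (apply Rdiv_lt_0_compat; lra).
  assert (E2 : 0 < Rmin 1 (eps / (2 * (Rabs a + 1)))).
  { apply Rmin_pos; [lra|]. apply Rdiv_lt_0_compat; lra. }
  destruct (Hx _ E1) as [d1 H1].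
  destruct (proj1 (filterlim_locally u (u t)) Hu (mkposreal _ E2)) as [d2 H2].
  assert (Hd : 0 < Rmin d1 d2) by (apply Rmin_pos; apply cond_pos).
  exists (mkposreal _ Hd). intros h h0 Hh. simpl in Hh.
  specialize (H1 h h0 (Rlt_le_trans _ _ _ Hh (Rmin_l _ _))).
  assert (A : Rabs (u (t + h) - u t) < Rmin 1 (eps / (2 * (Rabs a + 1)))).
  { apply (H2 (t + h)). change (Rabs (t + h - t) < d2).
    replace (t + h - t) with h by ring. exact (Rlt_le_trans _ _ _ Hh (Rmin_r _ _)). }
  assert (A1 := Rlt_le_trans _ _ _ A (Rmin_l _ _)).
  assert (A2 := Rlt_le_trans _ _ _ A (Rmin_r _ _)).
  set (Q := (x (t + h) - x t) / h - a) in *.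
  replace ((u (t + h) * (x (t + h) - x t) - u t * (x t - x t)) / h - u t * a)
    with (u (t + h) * Q + (u (t + h) - u t) * a) by (unfold Q; field; easy).
  eapply Rle_lt_trans; [apply Rabs_triang|]. rewrite !Rabs_mult.
  assert (B : Rabs (u (t + h)) <= Rabs (u t) + 1).
  { replace (u (t + h)) with (u t + (u (t + h) - u t)) by ring.
    eapply Rle_trans; [apply Rabs_triang|]. lra. }
  assert (C1 : Rabs (u (t + h)) * Rabs Q <= eps / 2).
  { apply Rle_trans with ((Rabs (u t) + 1) * (eps / (2 * (Rabs (u t) + 1)))).
    - apply Rmult_le_compat; auto using Rabs_pos. lra.
    - right. field. lra. }
  assert (C2 : Rabs (u (t + h) - u t) * Rabs a < eps / 2).
  { apply Rle_lt_trans with (eps / (2 * (Rabs a + 1)) * Rabs a).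
    - apply Rmult_le_compat_r; lra.
    - apply Rlt_le_trans with (eps / (2 * (Rabs a + 1)) * (Rabs a + 1)).
      + apply Rmult_lt_compat_l; [|lra]. apply Rdiv_lt_0_compat; lra.
      + right. field. lra. }
  lra.
Qed.

(** Chain rule along a real curve. Substituting the curve into
    [f w - f z = q w * (w - z)] and taking real parts leaves products of a
    continuous function and an increment. *)
Lemma is_derive_Re_curve (f : C -> C) (x y : R -> R) (t a b : R) (l : C) :
  cderiv f (x t, y t) l -> is_derive x t a -> is_derive y t b ->
  is_derive (fun s => Re (f (x s, y s))) t (Re (l * (a, b))%C).
Proof.
  intros [q [Hq [<- E]]] Hx Hy.
  assert (Cx : continuous x t) by (apply (ex_derive_continuous x t); now exists a).
  assert (Cy : continuous y t) by (apply (ex_derive_continuous y t); now exists b).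
  set (u := fun s => Re (q (x s, y s))).
  set (v := fun s => Re ((0, -1)%R * q (x s, y s))%C).
  assert (Hu : continuous u t) by now apply ccont_continuous_curve.
  assert (Hv : continuous v t).
  { apply (ccont_continuous_curve (fun z => ((0, -1)%R * q z)%C)); auto.
    apply ccont_mult; auto using ccont_const. }
  apply (is_derive_ext (fun s => Re (f (x t, y t)) + (u s * (x s - x t)
           + - v s * (y s - y t)))).
  - intros s. replace (f (x s, y s)) with
      (f (x t, y t) + (f (x s, y s) - f (x t, y t)))%C by ring.
    rewrite E. unfold u, v, Re. simpl. ring.
  - replace (Re (q (x t, y t) * (a, b))%C) with (0 + (u t * a + - v t * b)).
    2:{ unfold u, v, Re. simpl. ring. }
    apply (is_derive_plus (fun _ => Re (f (x t, y t)))).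
    { exact (is_derive_const (K := R_AbsRing) (V := R_NormedModule) _ t). }
    apply (is_derive_plus (fun s => u s * (x s - x t))).
    + now apply is_derive_continuous_mult_increment.
    + apply (is_derive_continuous_mult_increment (fun s => - v s)); [|easy].
      now apply (continuous_opp v).
Qed.

Lemma is_derive_Im_curve (f : C -> C) (x y : R -> R) (t a b : R) (l : C) :
  cderiv f (x t, y t) l -> is_derive x t a -> is_derive y t b ->
  is_derive (fun s => Im (f (x s, y s))) t (Im (l * (a, b))%C).
Proof.
  intros Hf Hx Hy.
  apply (is_derive_ext (fun s => Re ((0, -1)%R * f (x s, y s))%C)).
  { intros s. unfold Re, Im. simpl. ring. }
  replace (Im (l * (a, b))%C) with (Re ((0, -1)%R * l * (a, b))%C)
    by (unfold Re, Im; simpl; ring).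
  apply (is_derive_Re_curve (fun z => (0, -1)%R * f z)%C); auto.
  now apply cderiv_scal.
Qed.

(** * The derivative at the origin of a self-map of the disk *)

(** A continuous derivative is what differentiation under the integral sign
    requires, and, unlike local power series expansions, it passes to
    quotients and compositions by the rules of calculus alone. *)
Definition C1_holomorphic (f f' : C -> C) : Prop :=
  forall z, disk z -> cderiv f z (f' z) /\ ccont f' z.

Lemma Cmod_cos_sin (t : R) : Cmod (cos t, sin t) = 1.
Proof.
  unfold Cmod. simpl fst. simpl snd.
  replace (cos t ^ 2 + sin t ^ 2) with 1; [apply sqrt_1|].
  pose proof (sin2_cos2 t) as H. unfold Rsqr in H. lra.
Qed.

Definition polar (r t : R) : C := (r * cos t, r * sin t).

Lemma disk_polar (r t : R) : Rabs r < 1 -> disk (polar r t).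
Proof.
  intros Hr. unfold disk, polar.
  replace (r * cos t, r * sin t) with (RtoC r * (cos t, sin t))%C
    by (unfold RtoC, Cmult; simpl; f_equal; ring).
  rewrite Cmod_mult, Cmod_R.
  rewrite Cmod_cos_sin. lra.
Qed.

Lemma continuity_2d_cos (r t : R) : continuity_2d_pt (fun u v => u * cos v) r t.
Proof.
  apply continuity_2d_pt_mult; [apply continuity_2d_pt_id1|].
  apply (continuity_1d_2d_pt_comp cos (fun _ v => v)); [apply continuity_cos|].
  apply continuity_2d_pt_id2.
Qed.

Lemma continuity_2d_sin (r t : R) : continuity_2d_pt (fun u v => u * sin v) r t.
Proof.
  apply continuity_2d_pt_mult; [apply continuity_2d_pt_id1|].
  apply (continuity_1d_2d_pt_comp sin (fun _ v => v)); [apply continuity_sin|].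
  apply continuity_2d_pt_id2.
Qed.

Lemma continuous_cos_scal (r t : R) : continuous (fun v => r * cos v) t.
Proof. apply (ex_derive_continuous (fun v => r * cos v)). auto_derive. easy. Qed.

Lemma continuous_sin_scal (r t : R) : continuous (fun v => r * sin v) t.
Proof. apply (ex_derive_continuous (fun v => r * sin v)). auto_derive. easy. Qed.

Lemma locally_Rabs_lt_1 (r : R) : Rabs r < 1 -> locally r (fun s => Rabs s < 1).
Proof.
  intros Hr. assert (H : 0 < 1 - Rabs r) by lra.
  exists (mkposreal _ H). intros s Hs. change (Rabs (s - r) < 1 - Rabs r) in Hs.
  replace s with (r + (s - r)) by ring.
  eapply Rle_lt_trans; [apply Rabs_triang|]. lra.
Qed.

Definition rotated_Re (Phi : C -> C) (r t : R) : R :=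
  Re ((cos t, - sin t)%R * Phi (polar r t))%C.

Definition polar_Re (Psi : C -> C) (r t : R) : R := Re (Psi (polar r t)).

(** The real part of the first Fourier coefficient of [Phi] on the circle of
    radius [r], up to the factor [2 * PI]; for [Phi z = sum a_n z^n] it is
    [2 * PI * r * Re a_1]. *)
Definition circle_moment (Phi : C -> C) (r : R) : R :=
  RInt (rotated_Re Phi r) 0 (2 * PI).

Section Circle_mean.
Variables Phi Phi' : C -> C.
Hypothesis HPhi : C1_holomorphic Phi Phi'.

Lemma is_derive_rotated_Re (r t : R) : Rabs r < 1 ->
  is_derive (fun s => rotated_Re Phi s t) r (polar_Re Phi' r t).
Proof.
  intros Hr. destruct (HPhi _ (disk_polar r t Hr)) as [H _].
  unfold polar_Re. replace (Re (Phi' (polar r t))) with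
    (Re ((cos t, - sin t)%R * Phi' (polar r t) * (cos t, sin t)%R)%C).
  - apply (is_derive_Re_curve (fun z => (cos t, - sin t)%R * Phi z)%C
             (fun s => s * cos t) (fun s => s * sin t)).
    + now apply cderiv_scal.
    + auto_derive; [easy|ring].
    + auto_derive; [easy|ring].
  - pose proof (sin2_cos2 t). unfold Rsqr in H0.
    set (A := Phi' _). unfold Re. simpl.
    replace (fst A) with (fst A * (sin t * sin t + cos t * cos t)) at 3
      by (rewrite H0; ring). ring.
Qed.

Lemma continuous_polar_Re (r t : R) : Rabs r < 1 -> continuous (polar_Re Phi' r) t.
Proof.
  intros Hr. destruct (HPhi _ (disk_polar r t Hr)) as [_ H].
  apply (ccont_continuous_curve Phi' (fun v => r * cos v) (fun v => r * sin v));
    auto using continuous_cos_scal, continuous_sin_scal.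
Qed.

(** The Cauchy-Riemann equations in polar form, applied to
    [exp (- i t) * Phi (r * exp (i t))]: the angular derivative of its
    imaginary part is [r] times the radial derivative of its real part, minus
    that real part, which comes from the rotating factor. *)
Lemma is_derive_rotated_Im_angle (r t : R) : Rabs r < 1 ->
  is_derive (fun s => Im ((cos s, - sin s)%R * Phi (polar r s))%C) t
    (r * polar_Re Phi' r t - rotated_Re Phi r t).
Proof.
  intros Hr. destruct (HPhi _ (disk_polar r t Hr)) as [H _].
  assert (Dx : is_derive (fun s => r * cos s) t (- r * sin t)).
  { auto_derive; [easy|ring]. }
  assert (Dy : is_derive (fun s => r * sin s) t (r * cos t)).
  { auto_derive; [easy|ring]. }
  pose proof (is_derive_Re_curve Phi (fun s => r * cos s) (fun s => r * sin s)
                _ _ _ _ H Dx Dy) as HR.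
  pose proof (is_derive_Im_curve Phi (fun s => r * cos s) (fun s => r * sin s)
                _ _ _ _ H Dx Dy) as HI.
  set (F := fun s => Phi (polar r s)) in *.
  apply (is_derive_ext (fun s => cos s * Im (F s) - sin s * Re (F s))).
  { intros s. unfold F, Re, Im. simpl. ring. }
  set (A := Phi' (polar r t)) in *.
  evar_last.
  - apply (is_derive_minus (fun s => cos s * Im (F s)) (fun s => sin s * Re (F s))).
    + apply (is_derive_mult cos (fun s => Im (F s))); [|exact HI|apply Rmult_comm].
      apply is_derive_cos.
    + apply (is_derive_mult sin (fun s => Re (F s))); [|exact HR|apply Rmult_comm].
      apply is_derive_sin.
  - unfold polar_Re, rotated_Re. fold A. fold (F t).
    pose proof (sin2_cos2 t) as SC. unfold Rsqr in SC.
    unfold minus, plus, opp, mult, Re, Im; simpl.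
    replace (r * fst A) with (r * fst A * (sin t * sin t + cos t * cos t))
      by (rewrite SC; ring). ring.
Qed.

Lemma continuous_rotated_Re (r t : R) :
  Rabs r < 1 -> continuous (rotated_Re Phi r) t.
Proof.
  intros Hr. destruct (HPhi _ (disk_polar r t Hr)) as [H _].
  pose proof (cderiv_ccont _ _ _ H) as Hc.
  apply (continuous_ext (fun s => cos s * Re (Phi (polar r s))
    - sin s * Re ((0, 1)%R * Phi (polar r s))%C)).
  { intros s. unfold rotated_Re, Re. simpl. ring. }
  apply (continuous_minus (fun s => cos s * _) (fun s => sin s * _)).
  - apply (continuous_mult cos); [apply continuous_cos|].
    apply (ccont_continuous_curve Phi (fun v => r * cos v) (fun v => r * sin v));
    auto using continuous_cos_scal, continuous_sin_scal.
  - apply (continuous_mult sin); [apply continuous_sin|].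
    apply (ccont_continuous_curve (fun z => (0,1)%R * Phi z)%C
       (fun v => r * cos v) (fun v => r * sin v));
    auto using continuous_cos_scal, continuous_sin_scal.
    apply ccont_mult; auto using ccont_const.
Qed.

Lemma is_derive_circle_moment (r : R) : Rabs r < 1 ->
  is_derive (circle_moment Phi) r (RInt (polar_Re Phi' r) 0 (2 * PI)).
Proof.
  intros Hr.
  replace (RInt (polar_Re Phi' r) 0 (2 * PI))
    with (RInt (fun t => Derive (fun u => rotated_Re Phi u t) r) 0 (2 * PI)).
  2:{ apply RInt_ext. intros t _. apply is_derive_unique.
      now apply is_derive_rotated_Re. }
  apply (is_derive_RInt_param (rotated_Re Phi)).
  - generalize (locally_Rabs_lt_1 r Hr). apply filter_imp. intros s Hs t _.
    exists (polar_Re Phi' s t). now apply is_derive_rotated_Re.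
  - intros t _. apply (continuity_2d_pt_ext_loc (polar_Re Phi')).
    + destruct (locally_Rabs_lt_1 r Hr) as [d Hd]. exists d. intros u v Hu _.
      symmetry. apply is_derive_unique. apply is_derive_rotated_Re. now apply Hd.
    + destruct (HPhi _ (disk_polar r t Hr)) as [_ H].
      apply (ccont_continuity_2d Phi' (fun u v => u * cos v) (fun u v => u * sin v));
        auto using continuity_2d_cos, continuity_2d_sin.
  - generalize (locally_Rabs_lt_1 r Hr). apply filter_imp. intros s Hs.
    apply (ex_RInt_continuous (V := R_CompleteNormedModule)). intros t _.
    now apply continuous_rotated_Re.
Qed.

(** Integrating the angular derivative of the imaginary part over a full turn
    gives zero. With [is_derive_circle_moment] this says that [circle_moment Phi]
    satisfies Euler's relation for functions homogeneous of degree one. *)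
Lemma circle_moment_euler (r : R) :
  Rabs r < 1 -> circle_moment Phi r = r * RInt (polar_Re Phi' r) 0 (2 * PI).
Proof.
  intros Hr.
  assert (ED : ex_RInt (polar_Re Phi' r) 0 (2 * PI)).
  { apply (ex_RInt_continuous (V := R_CompleteNormedModule)). intros t _.
    now apply continuous_polar_Re. }
  assert (EP : ex_RInt (rotated_Re Phi r) 0 (2 * PI)).
  { apply (ex_RInt_continuous (V := R_CompleteNormedModule)). intros t _.
    now apply continuous_rotated_Re. }
  assert (H : is_RInt (fun t => r * polar_Re Phi' r t - rotated_Re Phi r t)
    0 (2 * PI) 0).
  { replace 0 with (minus
      (Im ((cos (2 * PI), - sin (2 * PI))%R
            * Phi (polar r (2 * PI)))%C)
      (Im ((cos 0, - sin 0)%R * Phi (polar r 0))%C)) at 2.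
    2:{ unfold polar. rewrite cos_2PI, sin_2PI, cos_0, sin_0.
      unfold minus, plus, opp; simpl. ring. }
    apply (is_RInt_derive (V := R_CompleteNormedModule)
      (fun s => Im ((cos s, - sin s)%R * Phi (polar r s))%C)).
    - intros t _. now apply is_derive_rotated_Im_angle.
    - intros t _. apply (continuous_minus (fun t => r * polar_Re Phi' r t)
        (rotated_Re Phi r)).
      + apply (continuous_mult (fun _ => r)); [apply continuous_const|].
        now apply continuous_polar_Re.
      + now apply continuous_rotated_Re. }
  apply (is_RInt_unique (V := R_CompleteNormedModule)) in H.
  assert (H' : RInt (fun t => r * polar_Re Phi' r t - rotated_Re Phi r t) 0 (2 * PI)
     = r * RInt (polar_Re Phi' r) 0 (2 * PI) - RInt (rotated_Re Phi r) 0 (2 * PI)).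
  { apply is_RInt_unique.
    apply (is_RInt_minus (fun t => r * polar_Re Phi' r t) (rotated_Re Phi r)).
    - apply (is_RInt_scal (polar_Re Phi' r)).
      now apply (RInt_correct (polar_Re Phi' r)).
    - now apply (RInt_correct (rotated_Re Phi r)). }
  unfold circle_moment. lra.
Qed.

Lemma circle_moment_bound (r : R) :
  Rabs r < 1 -> (forall z, disk z -> Cmod (Phi z) <= 1) ->
  circle_moment Phi r <= 2 * PI.
Proof.
  intros Hr HB. pose proof PI_RGT_0.
  apply Rle_trans with (RInt (fun _ => 1) 0 (2 * PI)).
  2:{ rewrite RInt_const. unfold scal; simpl. unfold mult; simpl. lra. }
  apply RInt_le; [lra| | |].
  - apply (ex_RInt_continuous (V := R_CompleteNormedModule)). intros t _.
    now apply continuous_rotated_Re.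
  - apply (ex_RInt_const (V := R_CompleteNormedModule)).
  - intros t _. unfold rotated_Re. eapply Rle_trans; [apply Rle_abs|].
    eapply Rle_trans; [apply re_le_Cmod|]. rewrite Cmod_mult.
    rewrite <- (cos_neg t), <- (sin_neg t), Cmod_cos_sin, Rmult_1_l.
    apply HB. now apply disk_polar.
Qed.

(** Let [I] be [circle_moment Phi]. The constant value of [I r / r] is at most
    [2 * PI / r] for every [r < 1], and tends to [I' 0 = 2 * PI * Re (Phi' 0)] as
    [r] tends to [0]. *)
Lemma Re_derivative_at_0_le (HB : forall z, disk z -> Cmod (Phi z) <= 1) :
  Re (Phi' 0%C) <= 1.
Proof.
  destruct (Rle_lt_dec (Re (Phi' 0%C)) 1) as [L|L]; [easy|exfalso].
  set (x := Re (Phi' 0%C)) in *. pose proof PI_RGT_0 as HPI.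
  (* The assumption 1 < x leaves room for a radius R0 < 1 with 1 / R0 < x. *)
  set (R0 := (/ x + 1) / 2).
  assert (Hx : 0 < / x < 1).
  { split; [apply Rinv_0_lt_compat; lra|].
    rewrite <- Rinv_1. apply Rinv_lt_contravar; lra. }
  assert (HR : / x < R0 < 1) by (unfold R0; lra).
  assert (J0 : RInt (polar_Re Phi' 0) 0 (2 * PI) = 2 * PI * x).
  { rewrite (RInt_ext (V := R_CompleteNormedModule) _ (fun _ => x)).
    - rewrite RInt_const. unfold scal; simpl. unfold mult; simpl. ring.
    - intros t _. unfold polar_Re, x, polar. rewrite !Rmult_0_l. reflexivity. }
  assert (A0 : Rabs 0 < 1) by (rewrite Rabs_R0; lra).
  assert (I0 : circle_moment Phi 0 = 0)
    by (rewrite circle_moment_euler by easy; ring).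
  (* The quotient has derivative zero by Euler's relation. *)
  assert (K : forall s, 0 < s < R0 ->
    circle_moment Phi s / s = circle_moment Phi R0 / R0).
  { intros s Hs.
    destruct (MVT_gen (fun r => circle_moment Phi r / r) s R0 (fun _ => 0))
      as [c [_ Hc]].
    - rewrite Rmin_left, Rmax_right by lra. intros c Hc.
      assert (Hc1 : Rabs c < 1) by (rewrite Rabs_pos_eq; lra).
      evar_last.
      + apply (is_derive_div (circle_moment Phi) (fun r => r));
          [now apply is_derive_circle_moment|apply is_derive_id|lra].
      + rewrite circle_moment_euler by easy. unfold one; simpl. field. lra.
    - rewrite Rmin_left, Rmax_right by lra. intros c Hc.
      assert (Hc1 : Rabs c < 1) by (rewrite Rabs_pos_eq; lra).
      apply derivable_continuous_pt. apply ex_derive_Reals_0.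
      eexists.
      apply (is_derive_div (circle_moment Phi) (fun r => r));
          [now apply is_derive_circle_moment|apply is_derive_id|lra].
    - lra. }
  assert (HRa : Rabs R0 < 1) by (rewrite Rabs_pos_eq; lra).
  assert (B : circle_moment Phi R0 / R0 < 2 * PI * x).
  { apply Rlt_div_l; [lra|]. eapply Rle_lt_trans; [now apply circle_moment_bound|].
    rewrite Rmult_assoc. rewrite <- (Rmult_1_r (2 * PI)) at 1.
    apply Rmult_lt_compat_l; [lra|].
    replace 1 with (x * / x) by (field; lra). apply Rmult_lt_compat_l; lra. }
  (* The difference quotients of the moment at 0 all equal that constant, which
     is smaller than the derivative there. *)
  assert (H := is_derive_circle_moment 0 A0).
  rewrite J0 in H. apply is_derive_Reals in H.
  destruct (H (2 * PI * x - circle_moment Phi R0 / R0)) as [d Hd]; [lra|].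
  set (s := Rmin (d / 2) (R0 / 2)). pose proof (cond_pos d).
  assert (S0 : 0 < s) by (apply Rmin_pos; lra).
  assert (S1 : s <= d / 2) by apply Rmin_l.
  assert (S2 : s <= R0 / 2) by apply Rmin_r.
  specialize (Hd s). rewrite Rplus_0_l, I0, Rminus_0_r, K in Hd by lra.
  assert (Hd' := Hd ltac:(lra) ltac:(rewrite Rabs_pos_eq; lra)).
  rewrite Rabs_left in Hd' by lra. lra.
Qed.
End Circle_mean.

(** * The Schwarz-Pick inequality *)

(** Multiplying [Phi] by the unimodular constant that makes [Phi' 0]
    nonnegative reduces the modulus to a real part. *)
Lemma schwarz_derivative (Phi Phi' : C -> C) :
  C1_holomorphic Phi Phi' -> (forall z, disk z -> Cmod (Phi z) <= 1) ->
  Cmod (Phi' 0%C) <= 1.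
Proof.
  intros HP HB. set (d := Phi' 0%C).
  destruct (Ceq_dec d 0%C) as [->|N]; [rewrite Cmod_0; lra|].
  assert (Hd : 0 < Cmod d) by now apply Cmod_gt_0.
  set (c := (Cconj d / RtoC (Cmod d))%C).
  assert (Hd' : RtoC (Cmod d) <> 0%C)
    by (apply Cmod_gt_0; rewrite Cmod_R, Rabs_pos_eq; lra).
  assert (Hc : Cmod c = 1).
  { unfold c. rewrite Cmod_div, Cmod_conj, Cmod_R, Rabs_pos_eq by (auto; lra).
    field. lra. }
  replace (Cmod d) with (Re (c * d)%C).
  - apply (Re_derivative_at_0_le (fun z => c * Phi z)%C (fun z => c * Phi' z)%C).
    + intros z Hz. destruct (HP z Hz). split; [now apply cderiv_scal|].
      apply ccont_mult; auto using ccont_const.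
    + intros z Hz. rewrite Cmod_mult, Hc, Rmult_1_l. auto.
  - replace (c * d)%C with (RtoC (Cmod d)); [apply re_RtoC|].
    transitivity (RtoC (Cmod d) ^ 2 / RtoC (Cmod d))%C; [field; auto|].
    rewrite <- RtoC_pow, Cmod2_conj. unfold c. field. auto.
Qed.

Lemma C1_holomorphic_comp (f f' g g' : C -> C) :
  C1_holomorphic f f' -> C1_holomorphic g g' ->
  (forall z, disk z -> disk (g z)) ->
  C1_holomorphic (fun z => f (g z)) (fun z => f' (g z) * g' z)%C.
Proof.
  intros Hf Hg Hd z Hz. destruct (Hg z Hz) as [G1 G2].
  destruct (Hf _ (Hd z Hz)) as [F1 F2]. split; [now apply cderiv_comp|].
  apply ccont_mult; [|easy]. apply (ccont_comp f' g); [|easy].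
  now apply (cderiv_ccont g z (g' z)).
Qed.

Definition mobius (c z : C) : C := ((z + c) / (1 + Cconj c * z))%C.

Definition mobius_deriv (c z : C) : C :=
  ((1 - c * Cconj c) / ((1 + Cconj c * z) * (1 + Cconj c * z)))%C.

Lemma mobius_denom_neq_0 (c z : C) :
  disk c -> disk z -> (1 + Cconj c * z)%C <> 0%C.
Proof.
  unfold disk. intros Hc Hz H.
  assert (E : Cmod (Cconj c * z) = 1).
  { replace (Cconj c * z)%C with ((1 + Cconj c * z) + - (1))%C by ring.
    rewrite H. replace (0 + - (1))%C with (- (1))%C by ring. apply Cmod_m1. }
  rewrite Cmod_mult, Cmod_conj in E.
  pose proof (Cmod_ge_0 c). pose proof (Cmod_ge_0 z). nra.
Qed.

(** The identity behind the invariance of the disk under these maps. *)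
Lemma mobius_defect (c z : C) :
  Cmod (1 + Cconj c * z) ^ 2 - Cmod (z + c) ^ 2
  = (1 - Cmod c ^ 2) * (1 - Cmod z ^ 2).
Proof.
  rewrite !Cmod2_alt. destruct c as [c1 c2], z as [z1 z2].
  unfold Re, Im. simpl. ring.
Qed.

Lemma disk_sqr (z : C) : disk z -> 0 < 1 - Cmod z ^ 2.
Proof. unfold disk. intros H. pose proof (Cmod_ge_0 z). nra. Qed.

Lemma mobius_disk (c z : C) : disk c -> disk z -> disk (mobius c z).
Proof.
  intros Hc Hz. unfold disk, mobius.
  pose proof (mobius_denom_neq_0 c z Hc Hz) as N.
  rewrite Cmod_div by easy. apply Cmod_gt_0 in N. apply Rlt_div_l; [easy|].
  pose proof (mobius_defect c z).
  pose proof (Rmult_lt_0_compat _ _ (disk_sqr c Hc) (disk_sqr z Hz)).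
  pose proof (Cmod_ge_0 (z + c)). nra.
Qed.

Lemma mobius_C1 (c : C) : disk c -> C1_holomorphic (mobius c) (mobius_deriv c).
Proof.
  intros Hc z Hz. pose proof (mobius_denom_neq_0 c z Hc Hz) as N. split.
  - replace (mobius_deriv c z) with
      (((1 + 0) * (1 + Cconj c * z) - (z + c) * (0 + Cconj c * 1))
        / ((1 + Cconj c * z) * (1 + Cconj c * z)))%C
      by (unfold mobius_deriv; field; exact N).
    apply (cderiv_div (fun w => w + c)%C (fun w => 1 + Cconj c * w)%C); [easy| |].
    + apply (cderiv_plus (fun w => w)); [apply cderiv_id|apply cderiv_const].
    + apply (cderiv_plus (fun _ => 1%C)); [apply cderiv_const|].
      apply cderiv_scal, cderiv_id.
  - assert (K : ccont (fun w => 1 + Cconj c * w)%C z).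
    { apply ccont_plus; [apply ccont_const|].
      apply ccont_mult; [apply ccont_const|apply ccont_id]. }
    apply ccont_mult; [apply ccont_const|].
    apply (ccont_inv (fun w => (1 + Cconj c * w) * (1 + Cconj c * w))%C).
    + now apply ccont_mult.
    + now apply Cmult_neq_0.
Qed.

Lemma one_minus_norm2 (c : C) : (1 - c * Cconj c)%C = RtoC (1 - Cmod c ^ 2).
Proof. rewrite RtoC_minus, Cmod2_conj. reflexivity. Qed.

(** The Schwarz lemma for the composition of [phi] with disk automorphisms
    moving [0] to [a] and [phi a] to [0], whose derivatives there are
    [1 - |a|^2] and [1 / (1 - |phi a|^2)]. *)
Lemma schwarz_pick (phi phi' : C -> C) (a : C) :
  C1_holomorphic phi phi' -> (forall z, disk z -> disk (phi z)) -> disk a ->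
  (1 - Cmod a ^ 2) * Cmod (phi' a) <= 1 - Cmod (phi a) ^ 2.
Proof.
  intros Hphi Hd Ha. set (b := phi a). assert (Hb : disk b) by now apply Hd.
  assert (Hmb : disk (- b)%C) by (unfold disk; now rewrite Cmod_opp).
  assert (Hda : forall z, disk z -> disk (phi (mobius a z))).
  { intros z Hz. apply Hd. now apply mobius_disk. }
  pose proof (schwarz_derivative _ _
    (C1_holomorphic_comp _ _ _ _ (mobius_C1 (- b)%C Hmb)
       (C1_holomorphic_comp _ _ _ _ Hphi (mobius_C1 a Ha)
          (fun z => mobius_disk a z Ha)) Hda)) as S.
  assert (E0 : mobius a 0%C = a).
  { unfold mobius. field. }
  cbv beta in S. rewrite E0 in S. fold b in S.
  pose proof (disk_sqr a Ha) as Pa. pose proof (disk_sqr b Hb) as Pb.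
  assert (Nb : RtoC (1 - Cmod b ^ 2) <> 0%C).
  { intros K. apply RtoC_inj in K. lra. }
  assert (E1 : (mobius_deriv (- b) b * (phi' a * mobius_deriv a 0))%C
    = (RtoC (1 - Cmod a ^ 2) * phi' a / RtoC (1 - Cmod b ^ 2))%C).
  { unfold mobius_deriv.
    replace (1 + Cconj (- b) * b)%C with (1 - b * Cconj b)%C
      by (rewrite Copp_conj; ring).
    replace (1 - - b * Cconj (- b))%C with (1 - b * Cconj b)%C
      by (rewrite Copp_conj; ring).
    rewrite !one_minus_norm2. rewrite Cmult_0_r, Cplus_0_r. field.
    exact Nb. }
  rewrite E1 in S. rewrite Cmod_div, Cmod_mult, !Cmod_R in S by easy.
  rewrite !Rabs_pos_eq in S by lra.
  assert (S' := S ltac:(intros z Hz; apply Rlt_le, (mobius_disk (- b)%C); auto)).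
  apply Rle_div_l in S'; lra.
Qed.

(** * Derivatives of functions analytic in the disk *)

Lemma analytic_in_disk_derive (f : C -> C) :
  analytic_in_disk f -> analytic_in_disk (C_derive f).
Proof. intros Hf z Hz. now apply analytic_at_derive, Hf. Qed.

Lemma analytic_in_disk_cderiv (f : C -> C) (z : C) :
  analytic_in_disk f -> disk z -> cderiv f z (C_derive f z).
Proof.
  intros Hf Hz. destruct (analytic_at_derive f z (Hf z Hz)) as [[r [Hr H]] _].
  apply H. now rewrite Cmod_sub_self.
Qed.

Lemma analytic_in_disk_C1 (f : C -> C) :
  analytic_in_disk f -> C1_holomorphic f (C_derive f).
Proof.
  intros Hf z Hz. split; [now apply analytic_in_disk_cderiv|].
  apply (cderiv_ccont _ z (C_derive (C_derive f) z)).
  apply analytic_in_disk_cderiv; [|easy]. now apply analytic_in_disk_derive.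
Qed.

Lemma disk_ball (z w : C) : Cmod (w - z) < 1 - Cmod z -> disk w.
Proof. unfold disk. intros H. pose proof (Cmod_le_sub z w). lra. Qed.

Lemma C_derive_subordinate (f F phi : C -> C) (z : C) :
  analytic_in_disk F -> analytic_in_disk phi ->
  (forall w, disk w -> disk (phi w)) ->
  (forall w, disk w -> f w = F (phi w)) -> disk z ->
  C_derive f z = (C_derive F (phi z) * C_derive phi z)%C.
Proof.
  intros HF Hp Hd E Hz. apply cderiv_C_derive.
  apply (cderiv_ext_loc (fun w => F (phi w)) _ _ _ (1 - Cmod z)).
  - unfold disk in Hz. lra.
  - intros w Hw. symmetry. apply E. now apply (disk_ball z).
  - apply (cderiv_comp F phi); apply analytic_in_disk_cderiv; auto.
Qed.

(** * Subordination of pre-Schwarzian derivatives *)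
Section Subordination.
Variables h g H G phi : C -> C.
Hypotheses (aH : analytic_in_disk H) (aG : analytic_in_disk G)
  (aphi : analytic_in_disk phi) (dphi : forall z, disk z -> disk (phi z))
  (Eh : forall z, disk z -> C_derive h z = C_derive H (phi z))
  (Eg : forall z, disk z -> C_derive g z = C_derive G (phi z)).

Lemma jacobian_subordinate (z : C) :
  disk z -> jacobian h g z = jacobian H G (phi z).
Proof. intros Hz. unfold jacobian. now rewrite Eh, Eg. Qed.

(** The chain rule gives a factor [phi'] in both terms of the numerator,
    because the conjugated first derivatives are merely composed with
    [phi]. *)
Lemma pre_schwarzian_subordinate (z : C) :
  disk z -> 0 < jacobian H G (phi z) ->
  pre_schwarzian h g z = (pre_schwarzian H G (phi z) * C_derive phi z)%C.
Proof.
  intros Hz HJ. unfold pre_schwarzian.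
  rewrite jacobian_subordinate by easy.
  rewrite (C_derive_subordinate (C_derive h) (C_derive H) phi),
    (C_derive_subordinate (C_derive g) (C_derive G) phi), Eh, Eg
    by auto using analytic_in_disk_derive.
  field. intros K. apply RtoC_inj in K. lra.
Qed.

(** The Schwarz-Pick lemma absorbs the factor [phi'] in the change of the
    weight [1 - |z|^2] under [phi]. *)
Lemma pre_schwarzian_norm_subordinate :
  sense_preserving H G ->
  Rbar_le (pre_schwarzian_norm h g) (pre_schwarzian_norm H G).
Proof.
  intros HS. apply (proj2 (Lub_Rbar_correct _)). intros x [z [Hz ->]].
  apply Rbar_le_trans
    with (Finite ((1 - Cmod (phi z) ^ 2) * Cmod (pre_schwarzian H G (phi z)))).
  - simpl Rbar_le. rewrite pre_schwarzian_subordinate by auto.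
    rewrite Cmod_mult.
    pose proof (schwarz_pick phi (C_derive phi) z (analytic_in_disk_C1 phi aphi)
                  dphi Hz) as SP.
    pose proof (Cmod_ge_0 (pre_schwarzian H G (phi z))). nra.
  - apply (proj1 (Lub_Rbar_correct _)). exists (phi z). auto.
Qed.
End Subordination.

(** * Shears of a harmonic mapping *)

(** Here [h1, h2] and [g1, g2] stand for the first and second derivatives of
    [h] and [g]. Multiplying the second derivative of [h + e g] by the Jacobian
    splits off the first derivative times the numerator of the
    pre-Schwarzian; what is left is the Wronskian of [h1] and [g1], times a
    factor that has the modulus of [h1 + e g1] because [e] is unimodular. *)
Lemma shear_identity_bound (h1 h2 g1 g2 e : C) :
  Cmod e = 1 ->
  Cmod (h2 + e * g2) * Rabs (Cmod h1 ^ 2 - Cmod g1 ^ 2) <=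
  Cmod (h1 + e * g1)
    * (Cmod (h2 * Cconj h1 - g2 * Cconj g1) + Cmod (g2 * h1 - h2 * g1)).
Proof.
  intros He.
  assert (Ee : (e * Cconj e)%C = 1%C) by (rewrite <- Cmod2_conj, He; f_equal; ring).
  assert (A : Cmod (e * Cconj h1 + Cconj g1) = Cmod (h1 + e * g1)).
  { rewrite <- (Cmod_conj (h1 + e * g1)), Cplus_conj, Cmult_conj.
    replace (e * Cconj h1 + Cconj g1)%C
      with (e * (Cconj h1 + Cconj e * Cconj g1))%C.
    - rewrite Cmod_mult, He. ring.
    - transitivity (e * Cconj h1 + e * Cconj e * Cconj g1)%C; [ring|].
      rewrite Ee. ring. }
  assert (E : ((h2 + e * g2) * RtoC (Cmod h1 ^ 2 - Cmod g1 ^ 2))%C =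
    ((h1 + e * g1) * (h2 * Cconj h1 - g2 * Cconj g1)
     + (g2 * h1 - h2 * g1) * (e * Cconj h1 + Cconj g1))%C).
  { rewrite RtoC_minus, !Cmod2_conj. ring. }
  rewrite <- Cmod_R, <- Cmod_mult, E.
  eapply Rle_trans; [apply Cmod_triangle|]. rewrite !Cmod_mult, A.
  right. ring.
Qed.

Lemma sense_preserving_neq_0 (h g : C -> C) (z : C) :
  sense_preserving h g -> disk z -> C_derive h z <> 0%C.
Proof.
  intros HS Hz K. pose proof (HS z Hz) as J. unfold jacobian in J.
  rewrite K, Cmod_0 in J. pose proof (pow2_ge_0 (Cmod (C_derive g z))).
  simpl in *. lra.
Qed.

(** The Schwarz-Pick lemma for the dilatation [g' / h'], a self-map of the
    disk since the mapping is sense-preserving. *)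
Lemma dilatation_wronskian_bound (h g : C -> C) (z : C) :
  analytic_in_disk h -> analytic_in_disk g -> sense_preserving h g -> disk z ->
  (1 - Cmod z ^ 2) * Cmod (C_derive (C_derive g) z * C_derive h z
                           - C_derive (C_derive h) z * C_derive g z)
  <= jacobian h g z.
Proof.
  intros Hh Hg HS Hz.
  set (h1 := C_derive h). set (g1 := C_derive g).
  set (h2 := C_derive h1). set (g2 := C_derive g1).
  assert (N : forall w, disk w -> h1 w <> 0%C)
    by (intros w; now apply (sense_preserving_neq_0 h g)).
  assert (ah1 : analytic_in_disk h1) by now apply analytic_in_disk_derive.
  assert (ag1 : analytic_in_disk g1) by now apply analytic_in_disk_derive.
  assert (HC : C1_holomorphic (fun w => g1 w / h1 w)%C
            (fun w => (g2 w * h1 w - g1 w * h2 w) / (h1 w * h1 w))%C).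
  { intros w Hw. destruct (analytic_in_disk_C1 h1 ah1 w Hw) as [Dh Ch].
    destruct (analytic_in_disk_C1 g1 ag1 w Hw) as [Dg Cg].
    fold h2 in Dh, Ch. fold g2 in Dg, Cg.
    pose proof (cderiv_ccont _ _ _ Dh). pose proof (cderiv_ccont _ _ _ Dg).
    split; [now apply cderiv_div; auto|].
    apply ccont_mult.
    - apply ccont_plus; [now apply ccont_mult|].
      apply (ccont_ext_loc (fun w => (- (1)) * (g1 w * h2 w))%C _ _ 1); [lra| |].
      + intros v _. ring.
      + apply ccont_mult; [apply ccont_const|now apply ccont_mult].
    - apply (ccont_inv (fun w => h1 w * h1 w)%C); [now apply ccont_mult|].
      apply Cmult_neq_0; auto. }
  assert (HD : forall w, disk w -> disk (g1 w / h1 w)%C).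
  { intros w Hw. unfold disk. rewrite Cmod_div by auto.
    assert (P := proj1 (Cmod_gt_0 _) (N w Hw)). apply Rlt_div_l; [easy|].
    pose proof (HS w Hw) as J. unfold jacobian in J. fold h1 g1 in J.
    pose proof (Cmod_ge_0 (g1 w)). nra. }
  pose proof (schwarz_pick _ _ z HC HD Hz) as SP. cbv beta in SP.
  assert (P := proj1 (Cmod_gt_0 _) (N z Hz)).
  rewrite !Cmod_div, Cmod_mult in SP by auto using Cmult_neq_0.
  apply (Rmult_le_compat_r (Cmod (h1 z) ^ 2)) in SP; [|apply pow2_ge_0].
  replace (g2 z * h1 z - h2 z * g1 z)%C with (g2 z * h1 z - g1 z * h2 z)%C by ring.
  unfold jacobian. fold h1 g1.
  set (W := Cmod (g2 z * h1 z - g1 z * h2 z)) in *.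
  replace ((1 - Cmod z ^ 2) * (W / (Cmod (h1 z) * Cmod (h1 z))) * Cmod (h1 z) ^ 2)
    with ((1 - Cmod z ^ 2) * W) in SP by (field; lra).
  replace ((1 - (Cmod (g1 z) / Cmod (h1 z)) ^ 2) * Cmod (h1 z) ^ 2)
    with (Cmod (h1 z) ^ 2 - Cmod (g1 z) ^ 2) in SP by (field; lra).
  exact SP.
Qed.

(** Each shear [h + e g] has a bounded pre-Schwarzian derivative: the
    Wronskian term adds at most [1] to the constant [M]. *)
Lemma shear_derivative_bound (h g : C -> C) (M : R) (e z : C) :
  analytic_in_disk h -> analytic_in_disk g -> sense_preserving h g -> disk z ->
  Cmod e = 1 -> (1 - Cmod z ^ 2) * Cmod (pre_schwarzian h g z) <= M ->
  (1 - Cmod z ^ 2) * Cmod (C_derive (C_derive h) z + e * C_derive (C_derive g) z)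
  <= (M + 1) * Cmod (C_derive h z + e * C_derive g z).
Proof.
  intros Hh Hg HS Hz He HM.
  pose proof (HS z Hz) as J. pose proof (disk_sqr z Hz) as D.
  pose proof (dilatation_wronskian_bound h g z Hh Hg HS Hz) as HW.
  pose proof (shear_identity_bound (C_derive h z) (C_derive (C_derive h) z)
    (C_derive g z) (C_derive (C_derive g) z) e He) as B.
  unfold pre_schwarzian in HM. fold (jacobian h g z) in B.
  rewrite Rabs_pos_eq in B by lra.
  rewrite Cmod_div in HM by (intros K; apply RtoC_inj in K; lra).
  rewrite Cmod_R, (Rabs_pos_eq (jacobian h g z)) in HM by lra.
  set (Jz := jacobian h g z) in *.
  set (X := Cmod (C_derive (C_derive h) z * Cconj (C_derive h z)
                  - C_derive (C_derive g) z * Cconj (C_derive g z))) in *.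
  set (W := Cmod (C_derive (C_derive g) z * C_derive h z
                  - C_derive (C_derive h) z * C_derive g z)) in *.
  set (K2 := Cmod (C_derive (C_derive h) z + e * C_derive (C_derive g) z)) in *.
  set (K1 := Cmod (C_derive h z + e * C_derive g z)) in *.
  assert (K0 : 0 <= K1) by apply Cmod_ge_0.
  assert (HX : (1 - Cmod z ^ 2) * X <= M * Jz).
  { apply (Rmult_le_compat_r Jz) in HM; [|lra].
    replace ((1 - Cmod z ^ 2) * (X / Jz) * Jz) with ((1 - Cmod z ^ 2) * X) in HM
      by (field; lra). exact HM. }
  apply Rmult_le_reg_r with Jz; [easy|].
  apply Rle_trans with (K1 * ((1 - Cmod z ^ 2) * X + (1 - Cmod z ^ 2) * W)).
  - apply (Rmult_le_compat_l (1 - Cmod z ^ 2)) in B; lra.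
  - replace ((M + 1) * K1 * Jz) with (K1 * (M * Jz + Jz)) by ring.
    apply Rmult_le_compat_l; lra.
Qed.

(** * Univalence from a bounded logarithmic derivative *)
Definition segment (w z : C) (t : R) : C :=
  (Re w + t * (Re z - Re w), Im w + t * (Im z - Im w)).

Lemma segment_0 (w z : C) : segment w z 0 = w.
Proof. destruct w. unfold segment, Re, Im. simpl. f_equal; ring. Qed.

Lemma segment_1 (w z : C) : segment w z 1 = z.
Proof. destruct z. unfold segment, Re, Im. simpl. f_equal; ring. Qed.

Lemma segment_in_ball (a w z : C) (rho t : R) :
  Cmod (w - a) < rho -> Cmod (z - a) < rho -> 0 <= t <= 1 ->
  Cmod (segment w z t - a) < rho.
Proof.
  intros Hw Hz Ht.
  replace (segment w z t - a)%C
    with (RtoC (1 - t) * (w - a) + RtoC t * (z - a))%C.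
  - eapply Rle_lt_trans; [apply Cmod_triangle|].
    rewrite !Cmod_mult, !Cmod_R, !Rabs_pos_eq by lra.
    destruct (Req_dec t 0) as [->|N]; [lra|].
    assert (t * Cmod (z - a) < t * rho) by (apply Rmult_lt_compat_l; lra).
    assert ((1 - t) * Cmod (w - a) <= (1 - t) * rho)
      by (apply Rmult_le_compat_l; lra). lra.
  - destruct w, z, a. unfold segment, Re, Im, RtoC. simpl.
    unfold Cminus, Cplus, Cmult, Copp. simpl. f_equal; ring.
Qed.

Lemma is_derive_Re_segment (f : C -> C) (w z : C) (t : R) (l : C) :
  cderiv f (segment w z t) l ->
  is_derive (fun s => Re (f (segment w z s))) t (Re (l * (z - w))%C).
Proof.
  intros Hf.
  apply (is_derive_Re_curve f (fun s => Re w + s * (Re z - Re w))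
           (fun s => Im w + s * (Im z - Im w)) t _ _ l Hf).
  - auto_derive; [easy|]. unfold Re. simpl. ring.
  - auto_derive; [easy|]. unfold Im. simpl. ring.
Qed.

Lemma is_derive_Re_mult_segment (c : C) (f : C -> C) (w z : C) (t : R) (l : C) :
  cderiv f (segment w z t) l ->
  is_derive (fun s => Re (c * f (segment w z s))%C) t (Re (c * l * (z - w))%C).
Proof.
  intros Hf. apply (is_derive_Re_segment (fun w => c * f w)%C).
  now apply cderiv_scal.
Qed.

Lemma is_derive_continuity_pt (f : R -> R) (t l : R) :
  is_derive f t l -> continuity_pt f t.
Proof.
  intros H. apply derivable_continuous_pt, ex_derive_Reals_0. now exists l.
Qed.

(** On a ball so small that [log k1] can vary only little, [k1] stays in a half
    plane, which forces [k] to be injective. *)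
Section Noshiro_Warschawski.
Variables (k k1 k2 : C -> C) (a : C) (rho L : R).
Hypotheses (rho_pos : 0 < rho) (L_pos : 0 <= L) (HL : L * rho <= / 4)
  (Hk : forall z, Cmod (z - a) < rho -> cderiv k z (k1 z))
  (Hk1 : forall z, Cmod (z - a) < rho -> cderiv k1 z (k2 z))
  (Hk2 : forall z, Cmod (z - a) < rho -> Cmod (k2 z) <= L * Cmod (k1 z))
  (k1a : k1 a <> 0%C).

(** A substitute for Gronwall's inequality: at a point [m] of the segment where
    [N = |k1|^2] is maximal, the mean value theorem and [|N'| <= N / 2] give
    [N m - N 0 <= N m / 2]. *)
Lemma derivative_growth (z : C) (t : R) :
  Cmod (z - a) < rho -> 0 <= t <= 1 ->
  Cmod (k1 (segment a z t)) <= 2 * Cmod (k1 a).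
Proof.
  intros Hz Ht.
  assert (Ha : Cmod (a - a) < rho) by now rewrite Cmod_sub_self.
  set (u := fun s => k1 (segment a z s)).
  set (N := fun s => Cmod (u s) ^ 2).
  set (dN := fun s => 2 * Re (Cconj (u s) * k2 (segment a z s) * (z - a))%C).
  assert (HN : forall s, 0 <= s <= 1 -> is_derive N s (dN s)).
  { intros s Hs. pose proof (segment_in_ball a a z rho s Ha Hz Hs) as B.
    (* Multiplication by -i = (0, -1) turns the imaginary part into a real
       part. *)
    apply (is_derive_ext (fun s => Re (u s) * Re (u s)
       + Re ((0, -1)%R * u s)%C * Re ((0, -1)%R * u s)%C)).
    { intros v. unfold N. rewrite Cmod2_alt. unfold Re, Im. simpl. ring. }
    pose proof (is_derive_Re_segment k1 a z s _ (Hk1 _ B)) as D1.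
    pose proof (is_derive_Re_mult_segment (0, -1)%R k1 a z s _ (Hk1 _ B)) as D2.
    evar_last.
    - apply (is_derive_plus (fun s => Re (u s) * Re (u s))).
      + apply (is_derive_mult (fun s => Re (u s)) (fun s => Re (u s)) s _ _ D1 D1).
        apply Rmult_comm.
      + apply (is_derive_mult (fun s => Re ((0, -1)%R * u s)%C)
          (fun s => Re ((0, -1)%R * u s)%C) s _ _ D2 D2).
        apply Rmult_comm.
    - unfold dN. set (A := k2 _). set (B' := (z - a)%C). set (U := u s).
      unfold plus, mult, Re, Im; simpl. ring. }
  assert (HdN : forall s, 0 <= s <= 1 -> Rabs (dN s) <= N s / 2).
  { intros s Hs. pose proof (segment_in_ball a a z rho s Ha Hz Hs) as B.
    unfold dN. rewrite Rabs_mult, (Rabs_pos_eq 2) by lra.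
    pose proof (re_le_Cmod (Cconj (u s) * k2 (segment a z s) * (z - a))) as R1.
    rewrite !Cmod_mult, Cmod_conj in R1.
    pose proof (Hk2 _ B) as R2. fold (u s) in R2. unfold N.
    set (U := Cmod (u s)) in *. assert (0 <= U) by apply Cmod_ge_0.
    assert (R3 : Cmod (k2 (segment a z s)) * Cmod (z - a) <= L * U * rho).
    { apply Rmult_le_compat; try apply Cmod_ge_0; lra. }
    assert (R4 : L * U * rho <= / 4 * U) by nra.
    assert (U * (Cmod (k2 (segment a z s)) * Cmod (z - a)) <= U * (/ 4 * U))
      by (apply Rmult_le_compat_l; lra). lra. }
  assert (HM : exists m, (forall s, 0 <= s <= 1 -> N s <= N m) /\ 0 <= m <= 1).
  { apply continuity_ab_maj; [lra|]. intros s Hs.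
    now apply (is_derive_continuity_pt _ _ (dN s)), HN. }
  destruct HM as [m [HM Hm]].
  assert (N0 : N 0 = Cmod (k1 a) ^ 2) by (unfold N, u; now rewrite segment_0).
  assert (Nm : N m <= 2 * N 0).
  { destruct (MVT_gen N 0 m dN) as [c [Hc E]].
    - rewrite Rmin_left, Rmax_right by lra. intros s Hs. apply HN. lra.
    - rewrite Rmin_left, Rmax_right by lra. intros s Hs.
      apply (is_derive_continuity_pt _ _ (dN s)), HN. lra.
    - rewrite Rmin_left, Rmax_right in Hc by lra.
      assert (Hc1 : 0 <= c <= 1) by lra.
      pose proof (HdN c Hc1). pose proof (HM c Hc1). pose proof (Rle_abs (dN c)).
      assert (0 <= N c) by apply pow2_ge_0. nra. }
  pose proof (HM t Ht) as H. rewrite N0 in Nm. unfold N at 1 in H. fold (u t).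
  pose proof (Cmod_ge_0 (u t)). pose proof (Cmod_ge_0 (k1 a)). nra.
Qed.

(** By [derivative_growth], [k1] moves by at most [|k1 a| / 2] along a radius. *)
Lemma derivative_half_plane (z : C) :
  Cmod (z - a) < rho -> 0 < Re (Cconj (k1 a) * k1 z)%C.
Proof.
  intros Hz. assert (Ha : Cmod (a - a) < rho) by now rewrite Cmod_sub_self.
  set (c := Cconj (k1 a)).
  set (p := fun s => Re (c * k1 (segment a z s))%C).
  set (dp := fun s => Re (c * k2 (segment a z s) * (z - a))%C).
  assert (Hp : forall s, 0 <= s <= 1 -> is_derive p s (dp s)).
  { intros s Hs. apply is_derive_Re_mult_segment, Hk1.
    now apply segment_in_ball. }
  destruct (MVT_gen p 0 1 dp) as [t [Ht E]].
  - rewrite Rmin_left, Rmax_right by lra. intros s Hs. apply Hp. lra.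
  - rewrite Rmin_left, Rmax_right by lra. intros s Hs.
    now apply (is_derive_continuity_pt _ _ (dp s)), Hp.
  - rewrite Rmin_left, Rmax_right in Ht by lra.
    unfold p in E. rewrite segment_0, segment_1 in E.
    assert (P : 0 < Cmod (k1 a)) by now apply Cmod_gt_0.
    assert (E0 : Re (c * k1 a)%C = Cmod (k1 a) ^ 2).
    { unfold c. rewrite Cmult_comm, <- Cmod2_conj. apply re_RtoC. }
    rewrite E0 in E.
    pose proof (segment_in_ball a a z rho t Ha Hz Ht) as B.
    pose proof (derivative_growth z t Hz Ht) as Gr.
    pose proof (re_le_Cmod (c * k2 (segment a z t) * (z - a))) as R1.
    fold (dp t) in R1. rewrite !Cmod_mult in R1. unfold c in R1.
    rewrite Cmod_conj in R1. pose proof (Hk2 _ B) as R2.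
    assert (R3 : Cmod (k2 (segment a z t)) * Cmod (z - a)
                 <= L * (2 * Cmod (k1 a)) * rho).
    { apply Rmult_le_compat; try apply Cmod_ge_0; [|lra].
      eapply Rle_trans; [exact R2|]. now apply Rmult_le_compat_l. }
    assert (R4 : L * (2 * Cmod (k1 a)) * rho <= Cmod (k1 a) / 2) by nra.
    assert (R5 : Rabs (dp t) <= Cmod (k1 a) * (Cmod (k1 a) / 2)).
    { eapply Rle_trans; [exact R1|]. rewrite Rmult_assoc.
      apply Rmult_le_compat_l; lra. }
    pose proof (Rle_abs (- dp t)) as R6. rewrite Rabs_Ropp in R6. nra.
Qed.

(** The Noshiro-Warschawski argument: if [k] took the same value at [z] and [w],
    the derivative of [Re (c * k)] would vanish somewhere on the segment
    between them, for every constant [c]. *)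
Lemma univalent_of_derivative_ratio :
  univalent_on k (fun z => Cmod (z - a) < rho).
Proof.
  intros z w Hz Hw E. destruct (Ceq_dec z w) as [H|N]; [easy|exfalso].
  assert (D : (z - w)%C <> 0%C).
  { intros H. apply N. replace z with ((z - w) + w)%C by ring. rewrite H. ring. }
  set (c := (Cconj (k1 a) * Cconj (z - w))%C).
  set (dp := fun s => Re (c * k1 (segment w z s) * (z - w))%C).
  destruct (MVT_gen (fun s => Re (c * k (segment w z s))%C) 0 1 dp) as [t [Ht M]].
  - rewrite Rmin_left, Rmax_right by lra. intros s Hs.
    apply is_derive_Re_mult_segment, Hk. apply segment_in_ball; auto; lra.
  - rewrite Rmin_left, Rmax_right by lra. intros s Hs.
    apply (is_derive_continuity_pt _ _ (dp s)).
    apply is_derive_Re_mult_segment, Hk. now apply segment_in_ball.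
  - rewrite Rmin_left, Rmax_right in Ht by lra.
    rewrite segment_0, segment_1, E in M.
    pose proof (derivative_half_plane _ (segment_in_ball a w z rho t Hw Hz Ht)) as P.
    assert (Q : dp t = Cmod (z - w) ^ 2 * Re (Cconj (k1 a) * k1 (segment w z t))%C).
    { unfold dp, c. rewrite <- re_scal_l, Cmod2_conj. f_equal. ring. }
    apply Cmod_gt_0 in D. apply (Rmult_lt_0_compat (Cmod (z - w) ^ 2)) in P.
    + lra.
    + now apply pow_lt.
Qed.
End Noshiro_Warschawski.

(** * Uniform local univalence *)

(** If [h + conj g] takes the same value at two points, the increments of [h]
    and [g] have the same modulus, so some shear [h + e g] with [e] unimodular
    takes the same value there as well. *)
Lemma univalent_of_shears (f h g : C -> C) (S : C -> Prop) :
  (forall z, S z -> f z = (h z + Cconj (g z))%C) ->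
  (forall e, Cmod e = 1 -> univalent_on (fun z => h z + e * g z)%C S) ->
  univalent_on f S.
Proof.
  intros Ef Hs z w Hz Hw E. rewrite !Ef in E by easy.
  assert (D : (h z - h w)%C = (- Cconj (g z - g w))%C).
  { rewrite Cminus_conj. transitivity
      ((h z + Cconj (g z)) - h w - Cconj (g z))%C; [ring|]. rewrite E. ring. }
  destruct (Ceq_dec (g z - g w) 0%C) as [G|G].
  - apply (Hs 1%C Cmod_1 z w Hz Hw). rewrite G in D.
    replace (h z) with ((h z - h w) + h w)%C by ring.
    replace (g z) with ((g z - g w) + g w)%C by ring. rewrite D, G.
    unfold Cconj, RtoC. simpl. rewrite Ropp_0. change (0, 0)%R with (RtoC 0). ring.
  - assert (He : Cmod (- ((h z - h w) / (g z - g w)))%C = 1).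
    { rewrite Cmod_opp, Cmod_div, D, Cmod_opp, Cmod_conj by easy. field.
      apply Cmod_gt_0 in G. lra. }
    apply (Hs _ He z w Hz Hw). field_simplify_eq; [ring|easy].
Qed.

(** [ln ((1 + t) / (1 - t))] is the hyperbolic radius of the disk of
    pseudo-hyperbolic radius [t], where
    [|z - a| < t * |1 - conj a * z| <= t * (1 - |a|^2 + |a| * |z - a|)]. *)
Lemma hyp_disk_in_ball (a z : C) (t : R) :
  0 < t <= / 2 -> disk a -> hyp_disk a (ln ((1 + t) / (1 - t))) z ->
  Cmod (z - a) < 4 * t * (1 - Cmod a).
Proof.
  intros Ht Ha [Hz Hd]. unfold hyp_dist, artanh in Hd.
  assert (Ha' : disk (- a)%C) by (unfold disk; now rewrite Cmod_opp).
  assert (Em : ((z - a) / (1 - Cconj a * z))%C = mobius (- a) z).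
  { unfold mobius. replace (1 + Cconj (- a) * z)%C with (1 - Cconj a * z)%C
      by (rewrite Copp_conj; ring). reflexivity. }
  pose proof (mobius_disk (- a) z Ha' Hz) as Hx. rewrite <- Em in Hx.
  pose proof (mobius_denom_neq_0 (- a) z Ha' Hz) as N.
  replace (1 + Cconj (- a) * z)%C with (1 - Cconj a * z)%C in N
    by (rewrite Copp_conj; ring).
  set (x := Cmod ((z - a) / (1 - Cconj a * z))%C) in *.
  assert (x0 : 0 <= x) by apply Cmod_ge_0. unfold disk in Hx. fold x in Hx.
  assert (Hxt : x < t).
  { destruct (Rlt_le_dec x t) as [Hlt|Hge]; [easy|exfalso].
    replace (2 * (ln ((1 + x) / (1 - x)) / 2)) with (ln ((1 + x) / (1 - x))) in Hd
      by field.
    apply ln_lt_inv in Hd; [|apply Rdiv_lt_0_compat; lra..].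
    apply (Rmult_lt_compat_r ((1 - x) * (1 - t))) in Hd;
      [|apply Rmult_lt_0_compat; lra].
    replace ((1 + x) / (1 - x) * ((1 - x) * (1 - t))) with ((1 + x) * (1 - t))
      in Hd by (field; lra).
    replace ((1 + t) / (1 - t) * ((1 - x) * (1 - t))) with ((1 + t) * (1 - x))
      in Hd by (field; lra). lra. }
  unfold x in Hxt. rewrite Cmod_div in Hxt by easy.
  apply Cmod_gt_0 in N. apply Rlt_div_l in Hxt; [|easy].
  assert (T : Cmod (1 - Cconj a * z) <= (1 - Cmod a ^ 2) + Cmod a * Cmod (z - a)).
  { replace (1 - Cconj a * z)%C with ((1 - a * Cconj a) + - (Cconj a * (z - a)))%C
      by ring.
    eapply Rle_trans; [apply Cmod_triangle|].
    rewrite one_minus_norm2, Cmod_R, Rabs_pos_eq, Cmod_opp, Cmod_mult, Cmod_conj.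
    - lra.
    - apply Rlt_le, disk_sqr, Ha. }
  unfold disk in Ha. pose proof (Cmod_ge_0 a). pose proof (Cmod_ge_0 (z - a)).
  set (A := Cmod a) in *. set (d := Cmod (z - a)) in *.
  assert (T2 : 1 - A ^ 2 + A * d <= 2 * (1 - A) + d) by nra.
  assert (T3 : t * Cmod (1 - Cconj a * z) <= t * (2 * (1 - A) + d))
    by (apply Rmult_le_compat_l; lra).
  assert (t * d <= / 2 * d) by (apply Rmult_le_compat_r; lra). lra.
Qed.

Lemma pre_schwarzian_norm_bound (h g : C -> C) :
  Rbar_lt (pre_schwarzian_norm h g) p_infty ->
  exists M, 0 <= M /\ forall z, disk z ->
    (1 - Cmod z ^ 2) * Cmod (pre_schwarzian h g z) <= M.
Proof.
  intros Hfin.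
  assert (UB : forall z, disk z -> Rbar_le
    ((1 - Cmod z ^ 2) * Cmod (pre_schwarzian h g z)) (pre_schwarzian_norm h g)).
  { intros z Hz. apply (proj1 (Lub_Rbar_correct _)). now exists z. }
  assert (D0 : disk 0%C) by (unfold disk; rewrite Cmod_0; lra).
  pose proof (UB 0%C D0) as U0.
  destruct (pre_schwarzian_norm h g) as [M| |]; [|easy|easy].
  exists M. split; [|exact UB]. simpl in U0. eapply Rle_trans; [|exact U0].
  apply Rmult_le_pos; [|apply Cmod_ge_0]. apply Rlt_le, (disk_sqr 0%C D0).
Qed.

(** The hyperbolic disk lies in the ball of radius [rho = 4 t (1 - |a|)] about
    [a], where [1 - |z|^2 >= (1 - |a|) / 2], so that every shear satisfies
    [|k''| <= L |k'|] with [L = 2 (M + 1) / (1 - |a|)]. The radius is chosen to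
    give [L * rho = 1 / 4], the smallness required by
    [univalent_of_derivative_ratio]. *)
Lemma univalent_hyp_disk (f h g : C -> C) (M : R) (a : C) :
  harmonic_mapping f h g -> sense_preserving h g -> 0 <= M ->
  (forall z, disk z -> (1 - Cmod z ^ 2) * Cmod (pre_schwarzian h g z) <= M) ->
  disk a ->
  let t := / (32 * (M + 1)) in
  univalent_on f (hyp_disk a (ln ((1 + t) / (1 - t)))).
Proof.
  intros [Hh [Hg [_ Ef]]] HS HM HB Ha t.
  assert (Ht : 0 < t <= / 32).
  { unfold t. split; [apply Rinv_0_lt_compat; lra|].
    apply Rinv_le_contravar; lra. }
  assert (A1 : 0 < 1 - Cmod a) by (unfold disk in Ha; lra).
  set (rho := 4 * t * (1 - Cmod a)). set (L := 2 * (M + 1) / (1 - Cmod a)).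
  assert (Hrho : 0 < rho) by (unfold rho; apply Rmult_lt_0_compat; lra).
  assert (rho_le : rho <= (1 - Cmod a) / 2) by (unfold rho; nra).
  assert (HLr : L * rho <= / 4) by (unfold L, rho, t; right; field; lra).
  assert (L0 : 0 <= L).
  { unfold L. apply Rlt_le, Rdiv_lt_0_compat; lra. }
  assert (Hball : forall z, Cmod (z - a) < rho -> disk z).
  { intros z Hz. apply (disk_ball a). lra. }
  apply (univalent_of_shears f h g).
  { intros z [Hz _]. now apply Ef. }
  intros e He z w Hz Hw.
  apply (univalent_of_derivative_ratio (fun z => h z + e * g z)%C
    (fun z => C_derive h z + e * C_derive g z)%C
    (fun z => C_derive (C_derive h) z + e * C_derive (C_derive g) z)%C
    a rho L); auto.
  - intros v Hv. apply Hball in Hv. apply cderiv_plus.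
    + now apply analytic_in_disk_cderiv.
    + now apply cderiv_scal, analytic_in_disk_cderiv.
  - intros v Hv. apply Hball in Hv. apply cderiv_plus.
    + apply analytic_in_disk_cderiv; auto using analytic_in_disk_derive.
    + apply cderiv_scal, analytic_in_disk_cderiv; auto using analytic_in_disk_derive.
  - intros v Hv. pose proof (Hball v Hv) as Dv.
    pose proof (shear_derivative_bound h g M e v Hh Hg HS Dv He (HB v Dv)) as B.
    set (K2 := Cmod (C_derive (C_derive h) v + e * C_derive (C_derive g) v)) in *.
    set (K1 := Cmod (C_derive h v + e * C_derive g v)) in *.
    assert (K20 : 0 <= K2) by apply Cmod_ge_0.
    pose proof (Cmod_le_sub a v). pose proof (Cmod_ge_0 v).
    assert (V : Cmod v <= (1 + Cmod a) / 2) by lra.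
    assert (Q : (1 - Cmod a) / 2 <= 1 - Cmod v ^ 2).
    { assert (0 <= Cmod v * (1 - Cmod v)) by (apply Rmult_le_pos; lra). lra. }
    assert (Q2 : (1 - Cmod a) / 2 * K2 <= (M + 1) * K1).
    { eapply Rle_trans; [|exact B]. now apply Rmult_le_compat_r. }
    unfold L. apply Rmult_le_reg_l with ((1 - Cmod a) / 2); [lra|].
    eapply Rle_trans; [exact Q2|]. right. field. lra.
  - intros K. pose proof (HS a Ha) as J. unfold jacobian in J.
    assert (E : C_derive h a = (- (e * C_derive g a))%C).
    { replace (C_derive h a) with
       ((C_derive h a + e * C_derive g a) - e * C_derive g a)%C by ring.
      rewrite K. ring. }
    rewrite E, Cmod_opp, Cmod_mult, He, Rmult_1_l in J. lra.
  - apply hyp_disk_in_ball; auto; lra.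
  - apply hyp_disk_in_ball; auto; lra.
Qed.

(** The hyperbolic radius of [univalent_hyp_disk] depends only on the
    norm. *)
Lemma uniformly_locally_univalent_of_norm (f h g : C -> C) :
  harmonic_mapping f h g -> sense_preserving h g ->
  Rbar_lt (pre_schwarzian_norm h g) p_infty ->
  uniformly_locally_univalent f h g.
Proof.
  intros Hf HS Hfin. split; [easy|]. split; [easy|].
  destruct (pre_schwarzian_norm_bound h g Hfin) as [M [HM HB]].
  set (t := / (32 * (M + 1))). set (rho := ln ((1 + t) / (1 - t))).
  assert (Ht : 0 < t <= / 32).
  { unfold t. split; [apply Rinv_0_lt_compat; lra|].
    apply Rinv_le_contravar; lra. }
  assert (Hrho : 0 < rho).
  { unfold rho. rewrite <- ln_1. apply ln_increasing; [lra|].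
    apply Rlt_div_r; lra. }
  apply Rbar_lt_le_trans with (Finite rho); [exact Hrho|].
  apply (proj2 (proj2_sig (Rbar_ex_glb _))). intros r [z [Hz ->]].
  apply (proj1 (Lub_Rbar_correct _)). split; [easy|].
  now apply (univalent_hyp_disk f h g M z).
Qed.

Theorem theorem9p1 (f h g F H G : C -> C)
  (Hf : harmonic_mapping f h g)
  (HF : class_BH F H G)
  (Hsub : harmonic_subordinate (C_derive h) (C_derive g)
                               (C_derive H) (C_derive G)) :
  Rbar_le (pre_schwarzian_norm h g) (pre_schwarzian_norm H G) /\
  uniformly_locally_univalent f h g.
Proof.
  destruct HF as [[[aH [aG _]] [HS _]] Hfin].
  destruct Hsub as [phi [aphi [dphi [Eh Eg]]]].
  assert (Le : Rbar_le (pre_schwarzian_norm h g) (pre_schwarzian_norm H G))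
    by now apply (pre_schwarzian_norm_subordinate h g H G phi).
  split; [exact Le|].
  apply uniformly_locally_univalent_of_norm; [easy| |].
  - intros z Hz. rewrite (jacobian_subordinate h g H G phi) by easy. auto.
  - now apply Rbar_le_lt_trans with (pre_schwarzian_norm H G).
Qed.
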